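(* Let $\mathfrak g=\mathbb R e_1\ltimes L$ be an almost abelian Lie algebra of dimension $D=N+1$ such that $\mathrm{ad}_{e_1}|_L=\mathcal J_N=\mathcal J_{N_{\mathbb R}}\oplus\mathcal J_{N_{\mathbb C}}$ is in real Jordan normal form (in the notation and block order described in the context), and let $0\le R\le D$ be an integer. Then $\mathfrak g$ admits a presymplectic form of rank $R$ if and only if $$R\in (R_{\mathcal J_{N_{\mathbb R}}}+R_{\mathcal J_{N_{\mathbb C}}})\ \cup\ (R_{\mathcal J_{N_{\mathbb R}}}+R_{\mathcal J_{N_{\mathbb C}}}+2).$$
   Context: All Lie algebras are real and finite-dimensional. An almost abelian Lie algebra is a non-abelian Lie algebra containing a codimension 1 abelian subalgebra; it can be written $\mathfrak g=\mathbb R e_1\ltimes L$ with $L=\mathrm{Span}(e_2,\dots,e_D)$ an abelian ideal, and its bracket is determined by $[e_1,v]=\mathrm{ad}_{e_1}v$, $v\in L$. A presymplectic form of rank $R$ on $\mathfrak g$ is a skew-symmetric bilinear form $\omega$ on $\mathfrak g$ of rank $R$ with $\omega(x,[y,z])+\omega(z,[x,y])+\omega(y,[z,x])=0$ for all $x,y,z\in\mathfrak g$. $\mathcal J_n(\lambda)$ is the $n\times n$ upper Jordan block with eigenvalue $\lambda\in\mathbb R$. $\mathcal C_n(a,b)$ ($b>0$) is the $2n\times 2n$ real Jordan block with diagonal $2\times2$ blocks $\begin{pmatrix}a&b\\-b&a\end{pmatrix}$ and superdiagonal $2\times 2$ blocks $I_2$. Real part: $\mathcal J_{N_{\mathbb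 R}}=\mathcal J^0_{\mathbb R}\oplus\bigoplus_{\mu=1}^{s}\left(\bigoplus_{r=1}^{k_\mu^+}\mathcal J_{n^+_{\mu,r}}(\lambda_\mu)\oplus\bigoplus_{r=1}^{k_\mu^-}\mathcal J_{n^-_{\mu,r}}(-\lambda_\mu)\right)$, of size $N_{\mathbb R}$, where $\mathcal J^0_{\mathbb R}=\bigoplus_{r=1}^{k_0}\mathcal J_{n_r^0}(0)$, the $\lambda_\mu>0$ are distinct, the block sizes $n_r^0$, and for each $\mu$ the block sizes $n_{\mu,r}^{+}$ and $n_{\mu,r}^-$, are in non-increasing order (some of the numbers of blocks may be $0$). Let $\vec L_{\lambda_\mu}=(n^+_{\mu,1},\dots,n^+_{\mu,k_\mu^+},0,\dots,0)$ and $\vec L_{-\lambda_\mu}=(n^-_{\mu,1},\dots,n^-_{\mu,k_\mu^-},0,\dots,0)$, padded by zeros to length $\max(k_\mu^+,k_\mu^-)$. Let $d_M$ be the Manhattan distance (sum of absolute values of differences of components), and let $N_{\mathcal J_{N_{\mathbb R}}}(\ell,\lambda)$ be the number of Jordan blocks of size $\ell$ with eigenvalue $\lambda$. Put $$\mathcal R_{\mathcal J_{N_{\mathbb R}}}=N_{\mathbb R}-\Big(\sum_{\ell\text{ odd}}\big(N_{\mathcal J_{N_{\mathbb R}}}(\ell,0)\bmod 2\big)+\sum_{\mu=1}^s d_M(\vec L_{\lambda_\mu},\vec L_{-\lambda_\mu})\Big),\qquad R_{\mathcal J_{N_{\mathbb R}}}=\{r\in2\mathbb Z: 0\le r\le\mathcal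 R_{\mathcal J_{N_{\mathbb R}}}\}.$$ Complex part: $\mathcal J_{N_{\mathbb C}}=\mathcal J^0_{\mathbb C}\oplus\mathcal J^{\ne0}_{\mathbb C}$, of size $N_{\mathbb C}=N-N_{\mathbb R}$, where $\mathcal J^0_{\mathbb C}$, of (real) size $N^0_{\mathbb C}$, is the direct sum of all blocks $\mathcal C_n(0,b)$ with eigenvalues of zero real part, and $\mathcal J^{\ne0}_{\mathbb C}=\bigoplus_{\mu}\left(\bigoplus_{r=1}^{k_\mu^+}\mathcal C_{n^+_{\mu,r}}(a_\mu,b_\mu)\oplus\bigoplus_{r=1}^{k_\mu^-}\mathcal C_{n^-_{\mu,r}}(-a_\mu,b_\mu)\right)$, of size $N^{\ne0}_{\mathbb C}$, with distinct pairs $(a_\mu,b_\mu)$, $a_\mu,b_\mu>0$, and sizes in non-increasing order for each $\mu$ and each sign (the indices $\mu$ and numbers $k^{\pm}_\mu, n^\pm_{\mu,r}$ here are independent of those of the real part). With $\vec L_{(a_\mu,b_\mu)}=(n^+_{\mu,1},\dots,n^+_{\mu,k_\mu^+},0,\dots,0)$ and $\vec L_{(-a_\mu,b_\mu)}=(n^-_{\mu,1},\dots,n^-_{\mu,k_\mu^-},0,\dots,0)$ (padded to length $\max(k_\mu^+,k_\mu^-)$), put $\mathcal R_{\mathcal J^{\ne0}_{\mathbb C}}=N^{\ne0}_{\mathbb C}-2\sum_\mu d_M(\vec L_{(a_\mu,b_\mu)},\vec L_{(-a_\mu,b_\mu)})$ and $$R_{\mathcal J_{N_{\mathbb C}}}=\{r\in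 4\mathbb Z:0\le r\le \mathcal R_{\mathcal J^{\ne0}_{\mathbb C}}\}+\{r\in2\mathbb Z:0\le r\le N^0_{\mathbb C}\}.$$ Sums of sets are Minkowski sums; $X+2=\{x+2:x\in X\}$. If the real (or complex) part is absent the corresponding set is $\{0\}$. *)

(* Defs.v *)
From HB Require Import structures.
From mathcomp Require Import all_boot all_order all_algebra.
From mathcomp Require Import classical_sets reals.

Set Implicit Arguments.
Unset Strict Implicit.
Unset Printing Implicit Defensive.

Import Order.TTheory GRing.Theory Num.Theory IntDist.

Local Open Scope classical_set_scope.
Local Open Scope ring_scope.

(** * Lie algebras *)

Record lieAlgebra (R : realType) := LieAlgebra {
  lie_sort :> vectType R;
  lie : {bilinear lie_sort -> lie_sort -> lie_sort};
  lie_alternating : forall x, lie x x = 0;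
  lie_jacobi : forall x y z,
    lie x (lie y z) + lie y (lie z x) + lie z (lie x y) = 0 }.

Arguments lie {R l}.

Section LieAlgebra.
Variables (R : realType) (g : lieAlgebra R).
Implicit Types L : {vspace g}.

Definition abelian_subspace L : Prop :=
  forall x y, x \in L -> y \in L -> lie x y = 0.

Definition lie_ideal L : Prop := forall x y, y \in L -> lie x y \in L.

(* An abelian subspace is automatically a subalgebra. *)
Definition almost_abelian : Prop :=
  ~ abelian_subspace fullv /\
  exists L, (\dim L).+1 = \dim {:g} /\ abelian_subspace L.

(* Column [j] holds the coordinates of [lie e1 e_j]. *)
Definition ad_mx n (e1 : g) (e : n.-tuple g) : 'M[R]_n :=
  \matrix_(i, j) coord e i (lie e1 e`_j).

Definition form_rank (omega : {biscalar g}) : nat :=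
  let b := vbasis {:g} in
  \rank (\matrix_(i < \dim {:g}, j < \dim {:g}) omega b`_i b`_j).

Definition presymplectic (omega : {biscalar g}) : Prop :=
  (forall x y, omega x y = - omega y x) /\
  (forall x y z,
     omega x (lie y z) + omega z (lie x y) + omega y (lie z x) = 0).

Definition admits_presymplectic_of_rank (k : nat) : Prop :=
  exists omega : {biscalar g}, presymplectic omega /\ form_rank omega = k.

End LieAlgebra.

(** * Real Jordan normal forms *)

Section JordanBlocks.
Variable R : realType.

Definition jordan_block (lambda : R) (n : nat) : 'M[R]_n :=
  \matrix_(i, j) (if i == j then lambda else (i.+1 == j :> nat)%:R).

Definition rot_block (a b : R) : 'M[R]_2 :=
  block_mx a%:M b%:M (- b)%:M (a%:M : 'M_1).

Definition complex_jordan_size (n : nat) : nat := (\sum_(i < n) 2)%N.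

Definition complex_jordan_block (ab : R * R) (n : nat) :
    'M[R]_(complex_jordan_size n) :=
  \mxblock_(i < n, j < n)
    (if i == j then rot_block ab.1 ab.2
     else if i.+1 == j :> nat then 1%:M else 0 : 'M_2).

End JordanBlocks.

(* [pos_sizes mu] lists the sizes of the blocks of eigenvalue [eigval mu], and
   [neg_sizes mu] those of the blocks with opposite real part. *)
Record signed_blocks (T : Type) := SignedBlocks {
  nvals : nat;
  eigval : 'I_nvals -> T;
  pos_sizes : 'I_nvals -> seq nat;
  neg_sizes : 'I_nvals -> seq nat }.

Definition block_sizes_wf (s : seq nat) : bool :=
  all (fun n => 0 < n)%N s && sorted geq s.

(* The default value of [nth] implements the padding by zeros. *)
Definition manhattan (s t : seq nat) : nat :=
  (\sum_(i < maxn (size s) (size t)) `|nth 0 s i - nth 0 t i|)%N.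

Section SignedBlocks.
Variables (R : realType) (T : Type).
(* [B v n] is the Jordan block with [n] diagonal entries (or diagonal 2 x 2
   blocks) for the eigenvalue [v]; [bdim n] is its real size. [opp] changes the sign of
   the real part. *)
Variables (opp : T -> T) (bdim : nat -> nat).
Variable (B : T -> forall n, 'M[R]_(bdim n)).
Variable F : signed_blocks T.

Definition blocks_dim (s : seq nat) : nat :=
  (\sum_(r < size s) bdim (nth 0 s r))%N.

Definition blocks_mx (v : T) (s : seq nat) : 'M[R]_(blocks_dim s) :=
  \mxdiag_(r < size s) B v (nth 0%N s r).

Definition signed_dim : nat :=
  (\sum_(mu < nvals F) (blocks_dim (pos_sizes mu) + blocks_dim (neg_sizes mu)))%N.

Definition signed_mx : 'M[R]_signed_dim :=
  \mxdiag_(mu < nvals F)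
    block_mx (blocks_mx (eigval mu) (pos_sizes mu)) 0
             0 (blocks_mx (opp (eigval mu)) (neg_sizes mu)).

Definition signed_dist : nat :=
  (\sum_(mu < nvals F) manhattan (pos_sizes mu) (neg_sizes mu))%N.

End SignedBlocks.

Record jordan_data (R : realType) := JordanData {
  real0 : seq nat;                    (* sizes of the blocks J_n(0) *)
  real1 : signed_blocks R;            (* blocks J_n(+- lambda) *)
  complex0 : seq (nat * R);           (* (n, b) stands for C_n(0, b) *)
  complex1 : signed_blocks (R * R) }. (* blocks C_n(+- a, b) *)

Section JordanData.
Variables (R : realType) (J : jordan_data R).

Definition jordan_data_wf : Prop :=
  [/\ block_sizes_wf (real0 J),
      [/\ injective (@eigval _ (real1 J)),
          forall mu, 0 < @eigval _ (real1 J) mu &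
          forall mu : 'I_(nvals (real1 J)),
            block_sizes_wf (pos_sizes mu) /\ block_sizes_wf (neg_sizes mu)],
      forall nb, nb \in complex0 J -> (0 < nb.1)%N /\ 0 < nb.2 &
      [/\ injective (@eigval _ (complex1 J)),
          forall mu, 0 < (@eigval _ (complex1 J) mu).1 /\
                     0 < (@eigval _ (complex1 J) mu).2 &
          forall mu : 'I_(nvals (complex1 J)),
            block_sizes_wf (pos_sizes mu) /\ block_sizes_wf (neg_sizes mu)]].

Definition real0_dim : nat := blocks_dim id (real0 J).
Definition real1_dim : nat := signed_dim id (real1 J).
Definition real_dim : nat := (real0_dim + real1_dim)%N.

Definition complex0_dim : nat :=
  (\sum_(r < size (complex0 J))
     complex_jordan_size (tnth (in_tuple (complex0 J)) r).1)%N.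
Definition complex1_dim : nat := signed_dim complex_jordan_size (complex1 J).
Definition complex_dim : nat := (complex0_dim + complex1_dim)%N.

Definition jordan_dim : nat := (real_dim + complex_dim)%N.

Definition real0_mx : 'M[R]_real0_dim :=
  blocks_mx (bdim := id) (@jordan_block R) 0 (real0 J).
Definition real1_mx : 'M[R]_real1_dim :=
  signed_mx -%R (bdim := id) (@jordan_block R) (real1 J).
Definition real_mx : 'M[R]_real_dim := block_mx real0_mx 0 0 real1_mx.

Definition complex0_mx : 'M[R]_complex0_dim :=
  \mxdiag_(r < size (complex0 J))
    complex_jordan_block (0, (tnth (in_tuple (complex0 J)) r).2)
                         (tnth (in_tuple (complex0 J)) r).1.
Definition complex1_mx : 'M[R]_complex1_dim :=
  signed_mx (fun ab => (- ab.1, ab.2)) (@complex_jordan_block R) (complex1 J).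
Definition complex_mx : 'M[R]_complex_dim :=
  block_mx complex0_mx 0 0 complex1_mx.

Definition jordan_mx : 'M[R]_jordan_dim := block_mx real_mx 0 0 complex_mx.

Definition num_real_blocks (l : nat) (lambda : R) : nat :=
  ((lambda == 0%R) * count_mem l (real0 J) +
   \sum_(mu < nvals (real1 J))
     ((lambda == eigval mu) * count_mem l (pos_sizes mu) +
      (lambda == (- eigval mu)%R) * count_mem l (neg_sizes mu)))%N.

(** * Ranks *)

(* No real block has size exceeding [real_dim], so the sum over odd sizes is
   finite. *)
Definition real_bound : int :=
  real_dim%:Z -
  ((\sum_(l < real_dim.+1 | odd l) (num_real_blocks l 0%R %% 2))%N%:Z +
   (signed_dist (real1 J))%:Z).

Definition real_ranks : set int :=
  [set r | (2 %| r)%Z /\ 0 <= r <= real_bound].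

Definition complex1_bound : int :=
  complex1_dim%:Z - 2 * (signed_dist (complex1 J))%:Z.

Definition minkowski_sum (A B : set int) : set int :=
  [set x + y | x in A & y in B].

Definition complex_ranks : set int :=
  minkowski_sum [set r | (4 %| r)%Z /\ 0 <= r <= complex1_bound]
                [set r | (2 %| r)%Z /\ 0 <= r <= complex0_dim%:Z].

End JordanData.

(* Main.v *)
Require Import Defs.
From HB Require Import structures.
From mathcomp Require Import all_boot all_order all_algebra.
From mathcomp Require Import classical_sets reals.
From mathcomp Require Import zify ring lra complex.

Set Implicit Arguments.
Unset Strict Implicit.
Unset Printing Implicit Defensive.

Import Order.TTheory GRing.Theory Num.Theory.

Local Open Scope classical_set_scope.
Local Open Scope ring_scope.

(** Let [L] be the abelian ideal spanned by [e], and [A] the matrix of [ad e1] on it.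
    Closedness of a skew form only constrains its restriction [S] to [L], by
    [A^T S + S A = 0]; the row [omega(e1, .)] is free.  Bordering [S] by this row raises
    the rank by 0 or 2, since skew matrices have even rank, and 2 is reached as soon as
    [S] is degenerate ([presymplectic_rankP]).  It remains to find the ranks of the skew
    matrices [S] with [A^T S + S A = 0].

    Upper bound ([rank_upper]).  Over the complex numbers, follow the rank of [S p(A)]
    while the linear factors of an annihilating polynomial [p] are multiplied in one at
    a time.  The drop caused by the (k+1)-st factor [A - l] depends on [l] and [k] only
    ([shift_rank_modular]), so that the rank of [S] is a sum of contributions of the
    eigenvalues.  By the Frobenius inequality this drop is at most the number of Jordan
    blocks for [l] of size larger than [k].  As [S p(A)] is the transpose of [S p(-A)]
    up to sign, the drops for [l] and for [-l] are equal; as [S] and [A] are real, so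
    are those for [l] and its conjugate.  Hence a pair of real eigenvalues [lambda],
    [- lambda] contributes an even number, at most twice the sum of the minima of the
    block sizes paired in non-increasing order; a pair of imaginary eigenvalues
    contributes an even number; and a quadruple [+- a +- i b] contributes a multiple of
    four.  For [l = 0], the matrices [S A^(2j)] are skew, so the drops number [2j] and
    [2j + 1], counted from 0, have an even sum, whereas the two numbers of blocks bounding them have
    a sum with the parity of the number of blocks of size [2j + 1]: one unit of rank is
    lost for each odd size of odd multiplicity ([ceig_rank0]).

    Lower bound ([rank_lower]).  An antidiagonal matrix with alternating signs, cut off
    at a suitable antidiagonal, intertwines the nilpotent blocks [- N^T] and [N] and
    takes any rank up to the smaller size.  Tensored with a 2 x 2 matrix where
    necessary, such matrices give all the ranks needed on one block with eigenvalue 0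
    or [i b], and on two blocks with opposite eigenvalues; direct sums do the rest. *)

(** * Sums and sequences *)

Lemma sum_decr (g : nat -> nat) N : (forall k, g k.+1 <= g k)%N ->
  (\sum_(k < N) (g k - g k.+1) = g 0 - g N)%N.
Proof.
move=> gd.
have gN : forall N, (g N <= g 0)%N by elim=> // k; apply: leq_trans.
elim: N => [|N IH]; first by rewrite big_ord0 subnn.
by rewrite big_ord_recr /= IH; have := gd N; have := gN N; lia.
Qed.

Lemma sum_leq_ord n r : (\sum_(i < n) (r <= i) = n - r)%N.
Proof.
elim: n => [|n IH]; first by rewrite big_ord0.
by rewrite big_ord_recr /= IH; case: leqP; lia.
Qed.

Lemma sum_ltn_ord N m : (\sum_(k < N) (k < m) = minn N m)%N.
Proof.
elim: N => [|N IH]; first by rewrite big_ord0 min0n.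
by rewrite big_ord_recr /= IH; case: ltnP; lia.
Qed.

Lemma sum_odd_half M (F : nat -> nat) :
  (\sum_(l < M | odd l) F l = \sum_(j < M./2) F j.*2.+1)%N.
Proof.
rewrite big_mkcond /=; elim: M => [|M IH]; first by rewrite !big_ord0.
rewrite big_ord_recr IH /= uphalf_half; case: ifP => oM; last by rewrite addn0.
by rewrite add1n big_ord_recr /=; congr (_ + F _)%N; lia.
Qed.

Lemma sum_uniq_le (u : seq nat) N (F : nat -> nat) : uniq u -> all (fun x => x < N)%N u ->
  (\sum_(x <- u) F x <= \sum_(x < N) F x)%N.
Proof.
move=> uu /allP uN; rewrite -(big_mkord xpredT F).
have pu : perm_eq (index_iota 0 N) (u ++ [seq x <- index_iota 0 N | x \notin u]).
  apply: uniq_perm; first exact: iota_uniq.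
    rewrite cat_uniq uu filter_uniq ?iota_uniq // andbT.
    by apply/hasPn => x; rewrite mem_filter => /andP[].
  move=> x; rewrite mem_cat mem_filter; case: (boolP (x \in u)) => //= /uN.
  by rewrite mem_index_iota.
by rewrite [leqRHS](perm_big _ pu) big_cat leq_addr.
Qed.

Lemma sum_undup_fibres (T : Type) (K : eqType) (key : T -> K) (F : T -> nat) s :
  (\sum_(k <- undup (map key s)) \sum_(x <- s) (key x == k) * F x = \sum_(x <- s) F x)%N.
Proof.
have H (s' : seq T) (L : seq K) : uniq L -> {subset map key s' <= L} ->
  (\sum_(k <- L) \sum_(x <- s') (key x == k) * F x = \sum_(x <- s') F x)%N.
  move=> uL; elim: s' => [|x s' IH] sL.
    by rewrite big_nil big1 // => k _; rewrite big_nil.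
  under eq_bigr do rewrite big_cons.
  rewrite big_split big_cons /= IH => [|k ks]; last by apply: sL; rewrite inE ks orbT.
  congr (_ + _)%N; rewrite -big_distrl /=.
  have xL : key x \in L by apply: sL; rewrite mem_head.
  rewrite (bigD1_seq (key x)) //= eqxx big1 ?addn0 ?mul1n // => k kx.
  by rewrite eq_sym (negPf kx).
by apply: H; rewrite ?undup_uniq // => k; rewrite mem_undup.
Qed.

(** Lists on which [key] is constant, with distinct constants, are disjoint. *)
Lemma uniq_flatten_key (T K : eqType) (key : T -> K) (ls : seq (K * seq T)) :
  uniq (unzip1 ls) -> all (fun p => uniq p.2 && all (fun z => key z == p.1) p.2) ls ->
  uniq (flatten (unzip2 ls)).
Proof.
elim: ls => //= -[k l] ls IH /= /andP[kls uls] /andP[/andP[ul /allP kl] als].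
rewrite cat_uniq ul IH //= andbT; apply/hasPn => z /flattenP[l' /mapP[[k' l''] pls /= ->]] zl.
apply/negP => /kl /eqP kz; case/negP: kls; rewrite -kz.
have /andP[_ /allP /(_ _ zl) /eqP /= ->] := allP als _ pls.
by apply/mapP; exists (k', l'').
Qed.

Lemma sum_pick (R : pzSemiRingType) n (F : nat -> R) (P : pred nat) k :
  (forall j, P j -> j = k) ->
  \sum_(i < n) F i * (P i)%:R = F k * (P k && (k < n)%N)%:R.
Proof.
move=> Pk; have [kn|kn] := ltnP k n; last first.
  rewrite andbF mulr0 big1 // => i _; case: (boolP (P i)) => [/Pk ik|]; last by rewrite mulr0.
  by move: (ltn_ord i); rewrite ik ltnNge kn.
rewrite (bigD1 (Ordinal kn)) //= andbT big1 ?addr0 // => i ne.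
by case: (boolP (P i)) => [/Pk ik|]; rewrite ?mulr0 //; case/eqP: ne; apply: val_inj.
Qed.

(** Number of boxes common to the Young diagrams of the partitions [s] and [t]. *)
Definition overlap (s t : seq nat) : nat :=
  (\sum_(i < maxn (size s) (size t)) minn (nth 0 s i) (nth 0 t i))%N.

(** Conjugation of partitions: row [i] is longer than [k] exactly when column [k] is
    longer than [i]. *)
Lemma lt_nth_sorted s i k : sorted geq s ->
  (k < nth 0 s i)%N = (i < count (ltn k) s)%N.
Proof.
elim: s i => [|x s IH] i /=; first by rewrite nth_nil !ltn0.
move=> px; have /allP mx : all (geq x) s by apply: order_path_min px => a b c /=; lia.
have ss := path_sorted px.
have [kx|xk] := ltnP k x.
  by case: i => [|i] /=; rewrite ?kx ?IH //; lia.
have -> : count (ltn k) s = 0%N.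
  apply/eqP; rewrite -leqn0 leqNgt -has_count; apply/hasPn => y /mx /=; lia.
rewrite addn0 ltn0; case: i => [|i] /=; first by apply/negbTE; lia.
have [si|si] := ltnP i (size s); last by rewrite nth_default.
by have /= := mx _ (mem_nth 0%N si); lia.
Qed.

Lemma sum_minn_overlap N s t : sorted geq s -> sorted geq t ->
  (\sum_(k < N) minn (count (ltn k) s) (count (ltn k) t) <= overlap s t)%N.
Proof.
move=> ss st; set M := maxn (size s) (size t).
have mE (k : nat) : minn (count (ltn k) s) (count (ltn k) t) =
    (\sum_(i < M) (k < minn (nth 0 s i) (nth 0 t i)))%N.
  under eq_bigr => i _ do rewrite leq_min !lt_nth_sorted // -leq_min.
  rewrite sum_ltn_ord; have := count_size (ltn k) s; have := count_size (ltn k) t.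
  rewrite /M; lia.
under eq_bigr do rewrite mE.
rewrite exchange_big /=; apply: leq_sum => i _.
by rewrite sum_ltn_ord geq_minr.
Qed.

Lemma manhattan_overlap s t :
  (manhattan s t + (overlap s t).*2 = sumn s + sumn t)%N.
Proof.
have sE (u : seq nat) M : (size u <= M)%N -> (sumn u = \sum_(i < M) nth 0 u i)%N.
  move=> uM; rewrite sumnE (big_nth 0%N) -(big_mkord xpredT (nth 0%N u)).
  rewrite (big_cat_nat (leq0n _) uM) /= [X in (_ = _ + X)%N]big_nat_cond.
  rewrite [X in (_ = _ + X)%N]big1 ?addn0 // => i /andP[/andP[ui _] _].
  by rewrite nth_default.
rewrite (sE s _ (leq_maxl _ (size t))) (sE t _ (leq_maxr (size s) _)).
rewrite /overlap -muln2 big_distrl -!big_split /=; apply: eq_bigr => i _.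
lia.
Qed.

Lemma sum_count_gt N s : (\sum_(k < N) count (ltn k) s <= sumn s)%N.
Proof.
elim: s => [|x s IH]; first by rewrite big1.
by rewrite /= big_split /= leq_add // sum_ltn_ord geq_minr.
Qed.

(** * Skew matrices *)

Section SkewRank.
Variable K : fieldType.
Hypothesis K2 : 2%:R != 0 :> K.

(** A rank factorisation turns [S] into [U^T k U] with [k] skew and invertible of size
    [\rank S]; an invertible skew matrix has even size, because
    [\det k = (-1) ^ r \det k]. *)
Lemma skew_rank_even n (S : 'M[K]_n) : S^T = - S -> ~~ odd (\rank S).
Proof.
move=> skS; have := mulmx_base S; have := row_base_free S.
move: (col_base S) (row_base S); set r := \rank S => X U /row_freeP[V UV] eS.
have eX : S *m V = X by rewrite -eS -mulmxA UV mulmx1.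
have VU : V^T *m U^T = 1%:M by rewrite -trmx_mul UV trmx1.
have eK : S = U^T *m (- X^T *m V) *m U.
  by rewrite mulNmx mulmxN mulmxA -trmx_mul eS skS [- S *m V]mulNmx opprK eX eS.
set k := - X^T *m V in eK.
have skk : k^T = - k.
  have eVk : k = V^T *m S *m V.
    by rewrite eK !mulmxA VU mul1mx -mulmxA UV mulmx1.
  by rewrite eVk !trmx_mul trmxK skS mulNmx mulmxN mulmxA.
have ku : k \in unitmx.
  rewrite -row_full_unit /row_full eqn_leq rank_leq_row.
  rewrite -[X in (X <= _)%N]/r /r {1}eK; apply: leq_trans (mxrankM_maxl _ _) _.
  exact: mxrankM_maxr.
apply/negP => odr.
have := congr1 determinant skk; rewrite det_tr -scaleN1r detZ -signr_odd odr expr1 mulN1r.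
move/eqP; rewrite -subr_eq0 opprK -mulr2n -mulr_natl mulf_eq0 (negPf K2) /=.
by move: ku; rewrite unitmxE unitfE => /negPf->.
Qed.
End SkewRank.

(** * Rank drops along the factors of a polynomial *)

Section Shifts.
Variable K : fieldType.

(** The monic polynomial with list of roots [s], evaluated at [A]; the arguments below
    apply its factors one at a time. *)
Definition shifts n (A : 'M[K]_n) (s : seq K) : 'M[K]_n :=
  foldr (fun l M => (A - l%:M) *m M) 1%:M s.

Lemma shifts_cat n (A : 'M[K]_n) s t : shifts A (s ++ t) = shifts A s *m shifts A t.
Proof. by elim: s => [|l s IH] /=; rewrite ?mul1mx // IH mulmxA. Qed.

Lemma shift_comm n (A : 'M[K]_n) l m :
  (A - l%:M) *m (A - m%:M) = (A - m%:M) *m (A - l%:M).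
Proof.
rewrite !mulmxBl !mulmxBr !mul_scalar_mx !mul_mx_scalar !scale_scalar_mx.
by rewrite (mulrC m) !opprB addrACA [RHS]addrACA; congr (_ + _); apply: addrC.
Qed.

Lemma shifts_comm1 n (A : 'M[K]_n) l s :
  (A - l%:M) *m shifts A s = shifts A s *m (A - l%:M).
Proof.
elim: s => [|m s IH] /=; first by rewrite mul1mx mulmx1.
by rewrite mulmxA shift_comm -!mulmxA IH.
Qed.

Lemma shifts_perm n (A : 'M[K]_n) s t : perm_eq s t -> shifts A s = shifts A t.
Proof.
elim: s t => [|l s IH] t; first by rewrite perm_sym => /perm_nilP->.
move=> /[dup] /perm_mem /(_ l); rewrite mem_head => /esym lt.
move: lt => /splitPr[t1 t2]; rewrite perm_sym -[l :: t2]cat1s perm_catCA perm_cons perm_sym.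
by move=> /IH /= ->; rewrite !shifts_cat /= !mulmxA shifts_comm1.
Qed.

Lemma tr_shifts n (A : 'M[K]_n) s : (shifts A s)^T = shifts A^T s.
Proof.
elim: s => [|l s IH] /=; first by rewrite trmx1.
by rewrite trmx_mul IH linearB /= tr_scalar_mx -shifts_comm1.
Qed.

Lemma mxrank_opp m n (A : 'M[K]_(m, n)) : \rank (- A) = \rank A.
Proof. by rewrite eqmx_opp. Qed.

Section Skew.
Variables (n : nat) (S A : 'M[K]_n).
Hypothesis skS : S^T = - S.
Hypothesis SA : A^T *m S + S *m A = 0.

Definition shift_rank s : nat := \rank (S *m shifts A s).

(** [S] intertwines [A] with [- A^T]; hence [S p(A) = p(- A^T) S]. *)
Lemma skew_shift l : S *m (A - l%:M) = - ((A^T - (- l)%:M) *m S).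
Proof.
rewrite mulmxBr mulmxBl -(addKr (A^T *m S) (S *m A)) SA addr0.
by rewrite raddfN /= mulNmx opprK opprD scalar_mxC.
Qed.

Lemma skew_shifts s :
  S *m shifts A s = (-1) ^+ size s *: (shifts A^T (map -%R s) *m S).
Proof.
elim: s => [|l s IH] /=; first by rewrite mulmx1 mul1mx scale1r.
rewrite mulmxA skew_shift mulNmx -[_ *m S *m _]mulmxA IH -scalemxAr -scaleN1r.
by rewrite scalerA exprS !mulmxA.
Qed.

Lemma shift_rank_perm s t : perm_eq s t -> shift_rank s = shift_rank t.
Proof. by move=> st; rewrite /shift_rank (shifts_perm _ st). Qed.

(** [(S p(A))^T = - S p(- A)]. *)
Lemma shift_rank_opp s : shift_rank (map -%R s) = shift_rank s.
Proof.
rewrite /shift_rank [in RHS]skew_shifts mxrank_scale_nz ?signr_eq0 //.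
by rewrite -[RHS]mxrank_tr trmx_mul tr_shifts trmxK skS mulNmx mxrank_opp.
Qed.

Lemma shift_rank_decr l s : (shift_rank (l :: s) <= shift_rank s)%N.
Proof. by rewrite /shift_rank /= shifts_comm1 mulmxA mxrankM_maxl. Qed.

(** The row spaces of [M B] and [M C], where [M = S p(A)], [B = A - l], [C = A - m], span
    that of [M], because [B - C] is an invertible scalar and both lie in it; they both
    contain that of [M B C].  This gives one inequality.  The other is the Frobenius
    inequality applied to [B' M C], where [M B = B' M]. *)
Lemma shift_rank_modular (l m : K) (s : seq K) : l != m ->
  (shift_rank s + shift_rank [:: l, m & s] = shift_rank (l :: s) + shift_rank (m :: s))%N.
Proof.
move=> lm; rewrite /shift_rank /=; set M := S *m shifts A s.
have stab k : exists B', M *m (A - k%:M) = B' *m M.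
  exists (- (A^T - (- k)%:M)).
  by rewrite /M -mulmxA -shifts_comm1 !mulmxA skew_shift !mulNmx.
have fS k : S *m ((A - k%:M) *m shifts A s) = M *m (A - k%:M).
  by rewrite shifts_comm1 mulmxA.
rewrite !fS; have -> : S *m ((A - l%:M) *m ((A - m%:M) *m shifts A s)) =
    M *m (A - l%:M) *m (A - m%:M).
  by rewrite shifts_comm1 [(A - l%:M) *m _]mulmxA shifts_comm1 !mulmxA.
set B := A - l%:M; set C := A - m%:M.
have [[B' MB] [C' MC]] := (stab l, stab m); rewrite -/B -/C in MB MC.
apply/eqP; rewrite eqn_leq; apply/andP; split; last first.
  by have := mxrank_Frobenius B' M C; rewrite -MB; lia.
rewrite -[X in (_ <= X)%N]mxrank_sum_cap leq_add //.
  apply: mxrankS.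
  have eM : M = (m - l)^-1 *: (M *m B - M *m C).
    have -> : M *m B - M *m C = (m - l) *: M.
      by rewrite -mulmxBr opprB addrC addrA subrK -raddfB mul_mx_scalar.
    by rewrite scalerA mulVf ?scale1r // subr_eq0 eq_sym.
  rewrite [X in (X <= _)%MS]eM; apply: scalemx_sub; apply: addmx_sub_adds => //.
  by rewrite eqmx_opp.
apply: mxrankS; rewrite sub_capmx; apply/andP; split.
  by rewrite -mulmxA [B *m C]shift_comm mulmxA MC -mulmxA; apply: submxMl.
by rewrite MB -mulmxA; apply: submxMl.
Qed.

(** The drop caused by one more factor [A - l] is insensitive to the other factors. *)
Lemma shift_rank_decouple1 (l : K) k (s : seq K) : l \notin s ->
  (shift_rank (nseq k.+1 l ++ s) + shift_rank (nseq k l) =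
   shift_rank (nseq k l ++ s) + shift_rank (nseq k.+1 l))%N.
Proof.
elim: s => [|m s IH]; first by rewrite !cats0 addnC.
rewrite inE negb_or => /andP[lm /IH {}IH].
have := shift_rank_modular (nseq k l ++ s) lm.
rewrite (@shift_rank_perm (l :: m :: _) (nseq k.+1 l ++ m :: s)); last first.
  by rewrite /= perm_cons -[m :: s]cat1s perm_sym perm_catCA.
rewrite (@shift_rank_perm (m :: _) (nseq k l ++ m :: s)); last first.
  by rewrite -[m :: s]cat1s perm_sym perm_catCA.
move: IH; rewrite -/(nseq k.+1 l ++ s) /=; lia.
Qed.

Lemma shift_rank_decouple (l : K) k (s : seq K) : l \notin s ->
  (shift_rank (nseq k l ++ s) + shift_rank [::] = shift_rank s + shift_rank (nseq k l))%N.
Proof.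
move=> ls; elim: k => [|k IH] //; have := shift_rank_decouple1 k ls; lia.
Qed.

(** The share of the eigenvalue [l] in the rank of [S]: the rank of [S] restricted to the
    generalized eigenspace of [l], since [n] factors [A - l] annihilate the latter. *)
Definition eig_rank l := (\rank S - shift_rank (nseq n l))%N.

Lemma shift_rank_nseq_le l k : (shift_rank (nseq k l) <= \rank S)%N.
Proof. by rewrite /shift_rank mxrankM_maxl. Qed.

Lemma rank_eig_sum (L : seq K) : uniq L ->
  (\rank S = \sum_(l <- L) eig_rank l + shift_rank (flatten [seq nseq n l | l <- L]) :> nat)%N.
Proof.
have f0 : shift_rank [::] = \rank S by rewrite /shift_rank mulmx1.
elim: L => [|l L IH] /=; first by rewrite big_nil f0.
move=> /andP[lL /IH {}IH]; rewrite big_cons {1}/eig_rank.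
have lf : l \notin flatten [seq nseq n l | l <- L].
  apply/negP => /flattenP[s /mapP[m mL ->]] /nseqP[elm _].
  by rewrite elm mL in lL.
have := shift_rank_decouple n lf; have := shift_rank_nseq_le l n; rewrite f0; lia.
Qed.

Definition eig_step l k := (shift_rank (nseq k l) - shift_rank (nseq k.+1 l))%N.

Lemma eig_rankE l : eig_rank l = (\sum_(k < n) eig_step l k)%N.
Proof.
rewrite (@sum_decr (fun k => shift_rank (nseq k l))) /= => [|k]; last exact: shift_rank_decr.
by rewrite /eig_rank /shift_rank mulmx1.
Qed.

Lemma eig_step_opp l k : eig_step (- l) k = eig_step l k.
Proof. by rewrite /eig_step -!map_nseq !shift_rank_opp. Qed.

Lemma eig_rank_opp l : eig_rank (- l) = eig_rank l.
Proof. by rewrite !eig_rankE; under eq_bigr do rewrite eig_step_opp. Qed.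

(** Frobenius inequality for the product of [S], [(A - l)^k] and [A - l]. *)
Lemma eig_step_le l k : (eig_step l k <=
  \rank (shifts A (nseq k l)) - \rank (shifts A (nseq k.+1 l)))%N.
Proof.
have frob a b c d : (c <= b -> a + c <= b + d -> a - d <= b - c)%N by lia.
rewrite /eig_step /shift_rank /= shifts_comm1.
apply: frob; [exact: mxrankM_maxl | rewrite mulmxA; exact: mxrank_Frobenius].
Qed.

(** [S A^(2j)] is skew, so its rank is even. *)
Lemma even_eig_step (K2 : 2%:R != 0 :> K) j :
  ~~ odd (eig_step 0 j.*2 + eig_step 0 j.*2.+1).
Proof.
have ev i : ~~ odd (shift_rank (nseq i.*2 0)).
  apply: (skew_rank_even K2); rewrite trmx_mul tr_shifts skS mulmxN.
  rewrite [in RHS]skew_shifts size_nseq -signr_odd odd_double scale1r.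
  by rewrite map_nseq oppr0.
have := ev j; have := ev j.+1; rewrite doubleS /eig_step.
have := shift_rank_decr 0 (nseq j.*2 0); have := shift_rank_decr 0 (nseq j.*2.+1 0).
rewrite -/(nseq _.+1 _) -/(nseq _.+2 _).
move: (shift_rank _) (shift_rank _) (shift_rank _) => x y z; lia.
Qed.

End Skew.
End Shifts.

(** * Similarity and direct sums *)

Section Similar.
Variable K : fieldType.

(** Similarity of matrices whose sizes are equal without being convertible: the sizes of
    the Jordan forms below are sums arranged in different ways. *)
Definition sim n m (A : 'M[K]_n) (B : 'M[K]_m) :=
  exists (X : 'M_(m, n)) (Y : 'M_(n, m)),
    [/\ X *m Y = 1%:M, Y *m X = 1%:M & X *m A = B *m X].

Lemma sim_refl n (A : 'M[K]_n) : sim A A.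
Proof. by exists 1%:M, 1%:M; rewrite !mulmx1 mul1mx. Qed.

Lemma sim_sym n m (A : 'M[K]_n) (B : 'M[K]_m) : sim A B -> sim B A.
Proof.
move=> [X [Y [XY YX XA]]]; exists Y, X; split=> //.
by rewrite -[LHS]mulmx1 -XY !mulmxA -(mulmxA Y) -XA mulmxA YX mul1mx.
Qed.

Lemma sim_trans n m p (A : 'M[K]_n) (B : 'M[K]_m) (C : 'M[K]_p) :
  sim A B -> sim B C -> sim A C.
Proof.
move=> [X [Y [XY YX XA]]] [Z [T [ZT TZ ZB]]]; exists (Z *m X), (Y *m T).
split; first by rewrite -mulmxA (mulmxA X) XY mul1mx.
  by rewrite -mulmxA (mulmxA T) TZ mul1mx.
by rewrite -mulmxA XA mulmxA ZB mulmxA.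
Qed.

Definition dirsum n m (A : 'M[K]_n) (B : 'M[K]_m) : 'M[K]_(n + m) :=
  block_mx A 0 0 B.

Lemma sim_dirsum n m n' m' (A : 'M[K]_n) (B : 'M[K]_m) (A' : 'M[K]_n') (B' : 'M[K]_m') :
  sim A A' -> sim B B' -> sim (dirsum A B) (dirsum A' B').
Proof.
move=> [X [Y [XY YX XA]]] [Z [T [ZT TZ ZB]]].
exists (block_mx X 0 0 Z), (block_mx Y 0 0 T).
by rewrite !mulmx_block !(mulmx0, mul0mx, addr0, add0r) XY YX ZT TZ XA ZB -!scalar_mx_block.
Qed.

Lemma sim_dirsumC n m (A : 'M[K]_n) (B : 'M[K]_m) : sim (dirsum A B) (dirsum B A).
Proof.
exists (block_mx 0 1%:M 1%:M 0), (block_mx 0 1%:M 1%:M 0).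
rewrite !mulmx_block !(mulmx0, mul0mx, mulmx1, mul1mx, addr0, add0r).
by rewrite -!scalar_mx_block.
Qed.

Lemma sim_castmx n m (A : 'M[K]_n) (e : n = m) : sim (castmx (e, e) A) A.
Proof. by case: m / e; rewrite castmx_id; apply: sim_refl. Qed.

Lemma sim_dirsumA n m p (A : 'M[K]_n) (B : 'M[K]_m) (C : 'M[K]_p) :
  sim (dirsum A (dirsum B C)) (dirsum (dirsum A B) C).
Proof.
rewrite /dirsum.
have := @block_mxA _ n m p n m p A 0 0 0 B 0 0 0 C; rewrite !row_mx0 !col_mx0 /= => ->.
exact: sim_castmx.
Qed.

Lemma sim_dirsum0 n (A : 'M[K]_n) (B : 'M[K]_0) : sim (dirsum A B) A.
Proof.
exists (row_mx 1%:M 0), (col_mx 1%:M 0); split.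
- by rewrite mul_row_col mulmx1 mulmx0 addr0.
- rewrite mul_col_row !(mulmx1, mulmx0, mul0mx) scalar_mx_block.
  by congr block_mx; apply/matrixP=> -[].
- rewrite mul_row_block mul_mx_row.
  by rewrite !(mulmx0, mul0mx, mulmx1, mul1mx, addr0).
Qed.

Lemma sim_dirsumCA n m p (A : 'M[K]_n) (B : 'M[K]_m) (C : 'M[K]_p) :
  sim (dirsum A (dirsum B C)) (dirsum B (dirsum A C)).
Proof.
apply: sim_trans (sim_dirsumA _ _ _) _.
apply: sim_trans (sim_sym (sim_dirsumA _ _ _)).
apply: sim_dirsum (sim_dirsumC _ _) (sim_refl _).
Qed.

Section DirectSum.
Variables (T : eqType) (d : T -> nat) (M : forall t, 'M[K]_(d t)).

Fixpoint dsum_dim (l : seq T) := if l is t :: l' then (d t + dsum_dim l')%N else 0%N.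

Fixpoint dsum (l : seq T) : 'M[K]_(dsum_dim l) :=
  if l is t :: l' then dirsum (M t) (dsum l') else 0.

Lemma dsum_cat l1 l2 : sim (dsum (l1 ++ l2)) (dirsum (dsum l1) (dsum l2)).
Proof.
elim: l1 => [|t l1 IH] /=.
  by apply: sim_sym; apply: sim_trans (sim_dirsumC _ _) (sim_dirsum0 _ _).
apply: sim_trans (sim_dirsum (sim_refl _) IH) _.
exact: sim_dirsumA.
Qed.

Lemma dsum_perm l1 l2 : perm_eq l1 l2 -> sim (dsum l1) (dsum l2).
Proof.
elim: l1 l2 => [|t l1 IH] l2.
  by rewrite perm_sym => /perm_nilP->; apply: sim_refl.
move=> /[dup] /perm_mem /(_ t); rewrite mem_head => /esym lt.
move: lt => /splitPr[t1 t2].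
rewrite perm_sym -[t :: t2]cat1s perm_catCA perm_cons perm_sym => /IH s.
apply: sim_trans (sim_dirsum (sim_refl _) s) _.
apply: sim_trans (sim_dirsum (sim_refl _) (dsum_cat _ _)) _.
apply: sim_trans (sim_dirsumCA _ _ _) _.
exact: sim_sym (dsum_cat t1 (t :: t2)).
Qed.

Lemma sim_mxdiag n (p : 'I_n -> nat) (A : forall i, 'M[K]_(p i)) (L : 'I_n -> seq T) :
  (forall i, sim (A i) (dsum (L i))) ->
  sim (\mxdiag_i A i) (dsum (flatten [seq L i | i <- enum 'I_n])).
Proof.
elim: n => [|n IH] in p A L *.
  move=> _; rewrite (_ : enum 'I_0 = [::]); last by apply/eqP; rewrite -size_eq0 size_enum_ord.
  have e0 : (\sum_(i < 0) p i = 0)%N by rewrite big_ord0.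
  have e : \mxdiag_i A i = 0.
    by apply/matrixP=> i; case: i => i Hi; exfalso; rewrite e0 in Hi.
  rewrite e /=; exists 0, 0; split; last by rewrite !mulmx0.
    by apply/matrixP=> -[].
  by apply/matrixP=> i; case: i => i Hi; exfalso; rewrite e0 in Hi.
move=> sA; rewrite mxdiag_recl enum_ordSl /= -map_comp.
apply: sim_trans (sim_castmx _ _) _.
apply: sim_trans (sim_sym (dsum_cat _ _)).
apply: sim_dirsum => //.
exact: IH.
Qed.
End DirectSum.

Lemma sim_rank_shifts n m (A : 'M[K]_n) (B : 'M[K]_m) s :
  sim A B -> \rank (shifts A s) = \rank (shifts B s).
Proof.
move=> [X [Y [XY YX XA]]].
have XS : X *m shifts A s = shifts B s *m X.
  elim: s => [|l s IH] /=; first by rewrite mulmx1 mul1mx.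
  rewrite -[RHS]mulmxA -IH !mulmxA; congr (_ *m _).
  by rewrite mulmxBr mulmxBl XA scalar_mxC.
have fX : row_free X by apply/row_freeP; exists Y.
have flX : row_full X by apply/row_fullP; exists Y.
by rewrite -(mxrankMfree (shifts B s) fX) -XS eqmxMfull.
Qed.

Lemma shifts_dirsum n m (A : 'M[K]_n) (B : 'M[K]_m) s :
  shifts (dirsum A B) s = dirsum (shifts A s) (shifts B s).
Proof.
elim: s => [|l s IH] /=; first by rewrite /dirsum -scalar_mx_block.
rewrite IH scalar_mx_block /dirsum opp_block_mx add_block_mx mulmx_block.
by rewrite !(oppr0, mulmx0, mul0mx, addr0, add0r).
Qed.

(** [bs] lists the eigenvalue and the size of each Jordan block of [A]: applying
    [c] factors [A - l] lowers the rank of a block of size [n] to [n - c] (truncated), and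
    the factors for other eigenvalues are invertible on it.  These ranks are all that
    the upper bound uses. *)
Definition jordan_type n (A : 'M[K]_n) (bs : seq (K * nat)) :=
  forall s, \rank (shifts A s) = (\sum_(b <- bs) (b.2 - count_mem b.1 s))%N.

Lemma jordan_type_sim n m (A : 'M[K]_n) (B : 'M[K]_m) bs :
  sim A B -> jordan_type A bs -> jordan_type B bs.
Proof. by move=> AB jA s; rewrite -(sim_rank_shifts _ AB). Qed.

Lemma jordan_type_dirsum n m (A : 'M[K]_n) (B : 'M[K]_m) b c :
  jordan_type A b -> jordan_type B c -> jordan_type (dirsum A B) (b ++ c).
Proof.
by move=> jA jB s; rewrite shifts_dirsum rank_diag_block_mx jA jB big_cat.
Qed.

(** One more factor [A - l] lowers the rank by one on each block for [l] that the
    previous [k] factors have not annihilated. *)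
Lemma count_gt_rank n (A : 'M[K]_n) bs l k : jordan_type A bs ->
  (\rank (shifts A (nseq k l)) - \rank (shifts A (nseq k.+1 l)) =
   count (fun b => (b.1 == l) && (k < b.2)) bs)%N.
Proof.
move=> jA; rewrite !jA -sum1_count [RHS]big_mkcond /=.
elim: bs {jA} => [|b bs IH]; first by rewrite !big_nil.
rewrite !big_cons -IH.
have : (\sum_(b <- bs) (b.2 - count_mem b.1 (nseq k.+1 l)) <=
        \sum_(b <- bs) (b.2 - count_mem b.1 (nseq k l)))%N.
  by apply: leq_sum => c _; rewrite /= leq_sub2l // leq_addl.
rewrite /= !count_nseq /= [l == _]eq_sym.
case: eqP => _ /=; last by lia.
by case: ltnP; lia.
Qed.

End Similar.

(** * Invariant skew forms *)

Section HasRank.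
Variable R : fieldType.

Definition invariant_skew_form n (A S : 'M[R]_n) :=
  S^T = - S /\ A^T *m S + S *m A = 0.

Definition has_rank n (A : 'M[R]_n) (r : nat) :=
  exists2 S : 'M[R]_n, invariant_skew_form A S & \rank S = r.

Lemma has_rank_sim n m (A : 'M[R]_n) (B : 'M[R]_m) r :
  sim A B -> has_rank A r -> has_rank B r.
Proof.
move=> /sim_sym[Y [X [YX XY YB]]] [S [skS SA] <-]; exists (Y^T *m S *m Y).
  split; first by rewrite !trmx_mul trmxK skS mulNmx mulmxN mulmxA.
  rewrite !mulmxA -trmx_mul YB -[_ *m Y *m B]mulmxA YB trmx_mul !mulmxA -mulmxDl.
  by rewrite -!(mulmxA Y^T) -mulmxDr SA mulmx0 mul0mx.
have fY : row_free Y by apply/row_freeP; exists X.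
have fullY : row_full Y^T by apply/row_fullP; exists X^T; rewrite -trmx_mul YX trmx1.
by rewrite -mulmxA eqmxMfull // mxrankMfree.
Qed.

Lemma has_rank_dirsum n m (A : 'M[R]_n) (B : 'M[R]_m) (r s : nat) :
  has_rank A r -> has_rank B s -> has_rank (dirsum A B) (r + s).
Proof.
move=> [S [skS SA] <-] [S' [skS' SB] <-]; exists (dirsum S S'); last first.
  by rewrite /dirsum rank_diag_block_mx.
rewrite /dirsum; split; first by rewrite tr_block_mx skS skS' !trmx0 opp_block_mx !oppr0.
rewrite tr_block_mx !trmx0 !mulmx_block !(mulmx0, mul0mx, addr0, add0r).
by rewrite add_block_mx SA SB !addr0 block_mx0.
Qed.

Lemma has_rank0 n (A : 'M[R]_n) : has_rank A 0.
Proof.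
by exists 0; rewrite ?mxrank0 //; split; rewrite ?trmx0 ?oppr0 // mulmx0 mul0mx addr0.
Qed.

Lemma mxrank_antiblock n m (B : 'M[R]_(n, m)) :
  \rank (block_mx 0 B (- B^T) 0) = (\rank B).*2.
Proof.
have fr : row_free (block_mx 0 1%:M 1%:M 0 : 'M[R]_(n + m, m + n)).
  apply/row_freeP; exists (block_mx 0 1%:M 1%:M 0).
  by rewrite mulmx_block !(mulmx0, mul0mx, mulmx1, addr0, add0r) -scalar_mx_block.
rewrite -(mxrankMfree _ fr) mulmx_block !(mulmx0, mul0mx, mulmx1, addr0, add0r).
by rewrite rank_diag_block_mx mxrank_opp mxrank_tr addnn.
Qed.

(** An intertwiner [B] between [- A^T] and [A'] spans an invariant form for which both
    summands are isotropic. *)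
Lemma has_rank_pair n m (A : 'M[R]_n) (A' : 'M[R]_m) (B : 'M[R]_(n, m)) :
  A^T *m B + B *m A' = 0 -> has_rank (dirsum A A') (\rank B).*2.
Proof.
move=> AB; exists (block_mx 0 B (- B^T) 0).
  split; first by rewrite tr_block_mx !trmx0 linearN /= trmxK opp_block_mx !oppr0 opprK.
  rewrite /dirsum tr_block_mx !trmx0 !mulmx_block !(mulmx0, mul0mx, addr0, add0r).
  have AB' : A'^T *m B^T + B^T *m A = 0.
    by rewrite -[A]trmxK -!trmx_mul -linearD addrC AB linear0.
  by rewrite add_block_mx AB mulmxN mulNmx -opprD AB' oppr0 !addr0 block_mx0.
exact: mxrank_antiblock.
Qed.

(** [B] and [P] have the same column space. *)
Lemma mxrank_proj n m (B : 'M[R]_(n, m)) (P : 'M_n) C :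
  P *m B = B -> B *m C = P -> \rank B = \rank P.
Proof.
move=> PB BC; apply/eqP; rewrite eqn_leq; apply/andP; split.
  by rewrite -{1}PB mxrankM_maxl.
by rewrite -BC mxrankM_maxl.
Qed.

Definition superdiag n : 'M[R]_n := \matrix_(i, j) (i.+1 == j :> nat)%:R.

(** Entries of alternating sign on the antidiagonal [i + j + 1 = u].  For a nilpotent
    Jordan block [N], the products [N^T B] and [B N] shift the entries of [B] along rows
    and columns, so they cancel when [B] alternates on antidiagonals and vanishes on
    those that the shift would move into the matrix, that is when [u] is at least both
    dimensions. *)
Definition antidiag n m u : 'M[R]_(n, m) :=
  \matrix_(i, j) ((-1) ^+ i * ((i + j).+1 == u)%:R).

Lemma antidiag_superdiag n m u : (n <= u)%N -> (m <= u)%N ->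
  (superdiag n)^T *m antidiag n m u + antidiag n m u *m superdiag m = 0.
Proof.
move=> nu mu; apply/matrixP => i j; rewrite !mxE.
under eq_bigr do rewrite !mxE mulrCA -natrM mulnb.
under [X in _ + X]eq_bigr do rewrite !mxE -mulrA -natrM mulnb.
rewrite (@sum_pick _ _ (fun k => (-1) ^+ k) (fun k => (k.+1 == i) && ((k + j).+1 == u)) i.-1);
  last by lia.
rewrite (@sum_pick _ _ (fun k => (-1) ^+ i) (fun k => ((i + k).+1 == u) && (k.+1 == j)) j.-1);
  last by lia.
have [in_ jm] := (ltn_ord i, ltn_ord j).
case: (val i) in_ => [|i'] in_.
  rewrite [X in (nat_of_bool X)%:R](_ : _ = false)
    ?[X in _ + _ * (nat_of_bool X)%:R](_ : _ = false) ?mulr0 ?addr0 //; lia.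
rewrite exprS mulN1r mulNr -mulrBr /=.
have -> : ((i'.+1 == i'.+1) && ((i' + j).+1 == u) && (i' < n)%N) =
   ((i'.+1 + j.-1).+1 == u) && (j.-1.+1 == j) && (j.-1 < m)%N by lia.
by rewrite subrr mulr0.
Qed.

(** On a square matrix: skew for even [u], symmetric for odd [u]. *)
Lemma tr_antidiag n m u : (antidiag n m u)^T = - (-1) ^+ u *: antidiag m n u.
Proof.
apply/matrixP => i j; rewrite !mxE addnC.
case: eqP => [<-|_]; last by rewrite !mulr0.
by rewrite !mulr1 exprS mulN1r opprK exprD mulrAC -expr2 sqrr_sign mul1r.
Qed.

Lemma copid_antidiag n m u :
  copid_mx (u - m) *m antidiag n m u = antidiag n m u.
Proof.
rewrite mulmxBl mul1mx [X in _ - X](_ : _ = 0) ?subr0 //.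
apply/matrixP => i j; rewrite !mxE big1 // => k _; rewrite !mxE.
case: eqP => [e|]; last by rewrite mul0r.
case: eqP => [e'|]; last by rewrite !mulr0.
by rewrite (_ : (i < _)%N = false) ?mul0r //; have := ltn_ord j; lia.
Qed.

Lemma antidiag_mul_tr n m u : (n <= u)%N ->
  antidiag n m u *m (antidiag n m u)^T = copid_mx (u - m).
Proof.
move=> nu; apply/matrixP => i j; rewrite !mxE.
under eq_bigr do rewrite !mxE mulrACA -natrM mulnb.
rewrite (@sum_pick _ _ (fun k => (-1) ^+ i * (-1) ^+ j)
  (fun k => ((i + k).+1 == u) && ((j + k).+1 == u)) (u - i.+1)); last by lia.
have := ltn_ord i; have := ltn_ord j => jn in_.
case: (eqVneq i j) => [<-|ij].
  rewrite -expr2 sqrr_sign mul1r eqxx /=.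
  have -> : ((i + (u - i.+1)).+1 == u) && ((i + (u - i.+1)).+1 == u) &&
      (u - i.+1 < m)%N = ~~ (i < u - m)%N by lia.
  by case: ltnP; rewrite ?subrr ?subr0.
rewrite [X in _ * (nat_of_bool X)%:R](_ : _ = false) ?mulr0; last first.
  by apply/negP => /andP[/andP[/eqP e1 /eqP e2] _]; case/eqP: ij; apply: val_inj => /=; lia.
by rewrite !(negPf (ij : val i != val j)) subrr.
Qed.

Lemma mxrank_antidiag n m u : (n <= u)%N -> (m <= u)%N -> (u <= n + m)%N ->
  \rank (antidiag n m u) = (n + m - u)%N.
Proof.
move=> nu mu unm.
rewrite (mxrank_proj (copid_antidiag n m u) (antidiag_mul_tr m nu)).
rewrite rank_copid_mx; lia.
Qed.

(** The Kronecker product, indexed in the same way as [complex_jordan_block]. *)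
Definition kron m n p q (M : 'M[R]_(m, n)) (G : 'M[R]_(p, q)) :
    'M[R]_(\sum_(i < m) p, \sum_(j < n) q) :=
  \mxblock_(i < m, j < n) (M i j *: G).

Lemma kron_mul m n k p q r (M : 'M[R]_(m, n)) (N : 'M[R]_(n, k))
    (G : 'M[R]_(p, q)) (H : 'M[R]_(q, r)) :
  kron M G *m kron N H = kron (M *m N) (G *m H).
Proof.
rewrite /kron mul_mxblock; apply/eq_mxblock => i j; rewrite mxE scaler_suml.
by apply: eq_bigr => l _; rewrite -scalemxAl -scalemxAr scalerA.
Qed.

Lemma tr_kron m n p q (M : 'M[R]_(m, n)) (G : 'M[R]_(p, q)) :
  (kron M G)^T = kron M^T G^T.
Proof.
rewrite /kron tr_mxblock; apply/eq_mxblock => i j.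
by rewrite mxE linearZ.
Qed.

Lemma kronDl m n p q (M N : 'M[R]_(m, n)) (G : 'M[R]_(p, q)) :
  kron (M + N) G = kron M G + kron N G.
Proof. by rewrite /kron -mxblockD; apply/eq_mxblock => i j; rewrite mxE scalerDl. Qed.

Lemma kronDr m n p q (M : 'M[R]_(m, n)) (G H : 'M[R]_(p, q)) :
  kron M (G + H) = kron M G + kron M H.
Proof. by rewrite /kron -mxblockD; apply/eq_mxblock => i j; rewrite scalerDr. Qed.

Lemma kronZl m n p q a (M : 'M[R]_(m, n)) (G : 'M[R]_(p, q)) :
  kron (a *: M) G = a *: kron M G.
Proof.
by apply/matrixP => k l; rewrite !mxE mulrA.
Qed.

Lemma kronZr m n p q a (M : 'M[R]_(m, n)) (G : 'M[R]_(p, q)) :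
  kron M (a *: G) = a *: kron M G.
Proof.
by apply/matrixP => k l; rewrite !mxE mulrCA.
Qed.

Lemma kron0l m n p q (G : 'M[R]_(p, q)) : kron (0 : 'M_(m, n)) G = 0.
Proof. by rewrite /kron -[RHS]mxblock0; apply/eq_mxblock => i j; rewrite mxE scale0r. Qed.

Lemma kron0r m n p q (M : 'M[R]_(m, n)) : kron M (0 : 'M_(p, q)) = 0.
Proof. by rewrite /kron -[RHS]mxblock0; apply/eq_mxblock => i j; rewrite scaler0. Qed.

Lemma kron_diag n p (D : 'M[R]_n) : is_diag_mx D ->
  kron D (1%:M : 'M_p) = \mxdiag_i (D i i)%:M.
Proof.
move=> /is_diag_mxP dD; apply/eq_mxblockP => i j.
case: (eqVneq i j) => [<-|ij]; last by rewrite dD ?scale0r.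
by rewrite conform_mx_id scalemx1.
Qed.

Lemma kron1 n p : kron (1%:M : 'M_n) (1%:M : 'M_p) = 1%:M.
Proof.
rewrite kron_diag ?scalar_mx_is_diag // -[RHS]mxdiagZ; apply/eq_mxdiag => i.
by rewrite mxE eqxx.
Qed.
End HasRank.

Lemma mxrank_kron_antidiag (R : fieldType) n m p u (G : 'M[R]_p) :
  G *m G^T = 1%:M -> (n <= u)%N -> (m <= u)%N -> (u <= n + m)%N ->
  \rank (kron (antidiag R n m u) G) = (p * (n + m - u))%N.
Proof.
move=> GG nu mu unm.
rewrite (@mxrank_proj _ _ _ _ (kron (copid_mx (u - m)) 1%:M) (kron (antidiag R n m u)^T G^T)).
- rewrite kron_diag; last first.
    apply/is_diag_mxP => i j; rewrite !mxE -val_eqE /= => /negPf->.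
    by rewrite subrr.
  rewrite rank_mxdiag; under eq_bigr => i _.
    rewrite !mxE !eqxx /=.
    have -> : \rank ((1 - (i < u - m)%N%:R)%:M : 'M[R]_p) = (p * (u - m <= i))%N.
      case: leqP; first by rewrite subr0 mxrank1 muln1.
      by rewrite subrr raddf0 mxrank0 muln0.
    over.
  rewrite -big_distrr sum_leq_ord /=; congr (_ * _)%N; lia.
- by rewrite kron_mul copid_antidiag mul1mx.
- by rewrite kron_mul antidiag_mul_tr // GG.
Qed.

(** * Forms on Jordan blocks *)

Section RealBlocks.
Variable R : realType.

Lemma jordan_blockE l n : jordan_block l n = l%:M + superdiag R n.
Proof.
apply/matrixP => i j; rewrite !mxE; case: (eqVneq i j) => [<-|_]; last by rewrite add0r.
by rewrite (_ : (_.+1 == _) = false) ?addr0 //; lia.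
Qed.

Lemma rot_blockE a b : rot_block a b = a%:M + b *: rot_block 0 1 :> 'M[R]_2.
Proof.
suff e : rot_block a b = a%:M + b *: (rot_block 0 1 : 'M_(1 + 1)) :> 'M[R]_(1 + 1).
  exact: e.
rewrite /rot_block scalar_mx_block scale_block_mx add_block_mx.
by rewrite !raddf0 !add0r !addr0 !scale_scalar_mx mulr1 mulrN1.
Qed.

Lemma complex_blockE ab n : complex_jordan_block ab n =
  kron 1%:M (rot_block ab.1 ab.2) + kron (superdiag R n) 1%:M.
Proof.
rewrite /kron /complex_jordan_block -mxblockD; apply/eq_mxblock => i j; rewrite !mxE.
case: (eqVneq i j) => [<-|_] /=.
  by rewrite scale1r (_ : (_.+1 == _) = false) ?scale0r ?addr0 //; lia.
by rewrite scale0r add0r; case: eqP => _; rewrite ?scale1r ?scale0r.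
Qed.

Lemma tr_rot1 : (rot_block 0 1)^T = - rot_block 0 1 :> 'M[R]_2.
Proof.
suff e : (rot_block 0 1 : 'M_(1 + 1))^T =
    - (rot_block 0 1 : 'M_(1 + 1)) :> 'M[R]_(1 + 1) by exact: e.
rewrite /rot_block tr_block_mx opp_block_mx !tr_scalar_mx raddf0 oppr0 -!raddfN /=.
by rewrite opprK.
Qed.

Lemma rot1_sqr : rot_block 0 1 *m rot_block 0 1 = - 1%:M :> 'M[R]_2.
Proof.
suff e : (rot_block 0 1 : 'M_(1 + 1)) *m (rot_block 0 1 : 'M_(1 + 1)) = - 1%:M :> 'M[R]_(1 + 1).
  exact: e.
rewrite /rot_block raddf0 mulmx_block !(mul0mx, mulmx0, addr0, add0r) -!scalar_mxM.
by rewrite mul1r mulr1 scalar_mx_block opp_block_mx oppr0 -raddfN.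
Qed.

(** The scalar parts [l] and [- l] cancel, so only the nilpotent parts matter. *)
Lemma real_pair_rank (l : R) n m j : (j <= n)%N -> (j <= m)%N ->
  has_rank (dirsum (jordan_block l n) (jordan_block (- l) m)) j.*2.
Proof.
move=> jn jm; rewrite -(_ : \rank (antidiag R n m (n + m - j)%N) = j); last first.
  by rewrite mxrank_antidiag; lia.
apply: has_rank_pair; rewrite !jordan_blockE linearD /= tr_scalar_mx mulmxDl mulmxDr.
rewrite addrACA antidiag_superdiag; [|lia..].
by rewrite addr0 scalar_mxC -mulmxDl -raddfD /= subrr raddf0 mul0mx.
Qed.

(** A single block carries [antidiag n n u] for [u = 2n - 2j], which is even as skewness
    requires; the rank of the form is then even too. *)
Lemma real_zero_rank n j : (j.*2 <= n)%N -> has_rank (jordan_block (0 : R) n) j.*2.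
Proof.
move=> jn; exists (antidiag R n n (n + n - j.*2)%N); last by rewrite mxrank_antidiag; lia.
split.
  rewrite tr_antidiag -signr_odd (_ : odd _ = false) ?scaleN1r //; lia.
by rewrite jordan_blockE raddf0 add0r antidiag_superdiag //; lia.
Qed.

Lemma complex_invariant ab ab' n m u (G : 'M[R]_2) : (n <= u)%N -> (m <= u)%N ->
  (rot_block ab.1 ab.2)^T *m G + G *m rot_block ab'.1 ab'.2 = 0 ->
  (complex_jordan_block ab n)^T *m kron (antidiag R n m u) G +
  kron (antidiag R n m u) G *m complex_jordan_block ab' m = 0.
Proof.
move=> nu mu rG; rewrite !complex_blockE linearD /= !tr_kron mulmxDl mulmxDr !kron_mul.
rewrite !trmx1 !mul1mx !mulmx1 addrACA -kronDl -kronDr rG antidiag_superdiag //.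
by rewrite kron0l kron0r addr0.
Qed.

(** With [J = rot_block 0 1], the transposed rotation part [a - b J] of one block is the
    opposite of the rotation part [- a + b J] of the other, so the identity matrix
    intertwines them; each unit of rank of [antidiag] gives 2 in the intertwiner and 4 in
    the form. *)
Lemma complex_pair_rank (a b : R) n m j : (j <= n)%N -> (j <= m)%N ->
  has_rank (dirsum (complex_jordan_block (a, b) n) (complex_jordan_block (- a, b) m))
    (4 * j).
Proof.
move=> jn jm.
have -> : (4 * j = (\rank (kron (antidiag R n m (n + m - j)%N) (1%:M : 'M_2))).*2)%N.
  by rewrite mxrank_kron_antidiag ?trmx1 ?mulmx1 //; lia.
apply: has_rank_pair; apply: complex_invariant; [lia..|] => /=.
rewrite mulmx1 mul1mx rot_blockE [X in _ + X]rot_blockE linearD linearZ /= tr_rot1.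
by rewrite tr_scalar_mx addrACA scalerN addNr addr0 -raddfD subrr raddf0.
Qed.

(** Both 1 and the skew matrix [J = rot_block 0 1] commute with the rotation part [b J],
    which is itself skew: taking
    [G] to be [J] when the antidiagonal matrix is symmetric and 1 when it is skew, the
    product is skew in either case, and there is no parity condition on [j]. *)
Lemma complex_zero_rank (b : R) n j : (j <= n)%N ->
  has_rank (complex_jordan_block (0, b) n) j.*2.
Proof.
move=> jn; set u := (n + n - j)%N.
pose G : 'M[R]_2 := if odd u then rot_block 0 1 else 1%:M.
exists (kron (antidiag R n n u) G); last first.
  rewrite mxrank_kron_antidiag /u; [by lia| |lia..].
  by rewrite /G; case: ifP => _; rewrite ?trmx1 ?mulmx1 // tr_rot1 mulmxN rot1_sqr opprK.
split.
  rewrite tr_kron tr_antidiag kronZl -signr_odd /G.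
  case: (odd u); last by rewrite trmx1 scaleN1r.
  by rewrite opprK scale1r tr_rot1 -[- _ in LHS]scaleN1r /kron -mxblockN;
     apply/eq_mxblock => i k; rewrite scaleN1r scalerN.
apply: complex_invariant; rewrite /u; [lia..|].
rewrite /= rot_blockE raddf0 add0r linearZ /= tr_rot1 -scalemxAl -scalemxAr mulNmx scalerN.
rewrite /G; case: ifP => _; first by rewrite addNr.
by rewrite mulmx1 mul1mx addNr.
Qed.

End RealBlocks.

(** * Jordan blocks over the complex numbers *)

Section JordanBlockType.
Variable K : fieldType.

Definition jblock (l : K) n : 'M[K]_n := l%:M + superdiag K n.

Lemma jblock_subC l m n : jblock l n - m%:M = jblock (l - m) n.
Proof. by rewrite /jblock raddfB /= addrAC. Qed.

Lemma jblock_unit l n : l != 0 -> jblock l n \in unitmx.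
Proof.
move=> l0; rewrite unitmxE unitfE -det_tr det_trig.
  apply/prodf_neq0 => i _; rewrite !mxE eqxx mulr1n (_ : (_.+1 == _) = false) ?addr0 //; lia.
apply/is_trig_mxP => i j ij; rewrite !mxE.
rewrite -val_eqE /= (_ : (_.+1 == _) = false) ?addr0 ?gtn_eqF //; lia.
Qed.

Lemma shifts_jblock l n k :
  shifts (jblock l n) (nseq k l) = \matrix_(i, j) (i + k == j)%N%:R.
Proof.
elim: k => [|k IH] /=.
  by apply/matrixP => i j; rewrite !mxE addn0.
rewrite IH jblock_subC subrr /jblock raddf0 add0r; apply/matrixP => i j; rewrite !mxE.
under eq_bigr do rewrite !mxE -natrM mulnb -[_%:R]mul1r.
rewrite (@sum_pick _ _ (fun => 1) (fun m => (i.+1 == m) && (m + k == j)) i.+1); last by lia.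
by rewrite mul1r; congr (_%:R); have := ltn_ord j; lia.
Qed.

Lemma rank_shifts_jblock l n k : \rank (shifts (jblock l n) (nseq k l)) = (n - k)%N.
Proof.
rewrite shifts_jblock; set B := (X in \rank X).
rewrite (@mxrank_proj _ _ _ B (pid_mx (n - k)) B^T).
- by rewrite rank_pid_mx ?leq_subr.
- apply/matrixP => i j; rewrite !mxE.
  under eq_bigr do rewrite !mxE -natrM mulnb -[_%:R]mul1r.
  rewrite (@sum_pick _ _ (fun => 1)
     (fun m => (i == m :> nat) && (i < n - k)%N && (m + k == j)%N) i); last by lia.
  by rewrite mul1r; congr (_%:R); have := ltn_ord j; have := ltn_ord i; lia.
- apply/matrixP => i j; rewrite !mxE.
  under eq_bigr do rewrite !mxE -natrM mulnb -[_%:R]mul1r.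
  rewrite (@sum_pick _ _ (fun => 1)
     (fun m => (i + k == m)%N && (j + k == m)%N) (i + k)%N); last by lia.
  by rewrite mul1r; congr (_%:R); lia.
Qed.

(** The factors [A - m] with [m != l] are invertible; [(A - l)^k] is the [k]-th
    superdiagonal. *)
Lemma jordan_type_jblock l n : jordan_type (jblock l n) [:: (l, n)].
Proof.
move=> s; rewrite big_seq1 /=.
have -> : shifts (jblock l n) s =
    shifts (jblock l n) ([seq m <- s | m != l] ++ nseq (count_mem l s) l).
  apply: shifts_perm; rewrite -(perm_filterC (predC1 l)) perm_cat2l.
  have /all_pred1P -> : all (pred1 l) [seq m <- s | predC (predC1 l) m].
    by rewrite all_filter; apply/allP => m _ /=; apply/implyP; rewrite negbK.
  by rewrite size_filter (@eq_count _ _ (pred1 l)) // => m /=; rewrite negbK.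
rewrite shifts_cat; set s' := filter _ _.
have : all (fun m => m != l) s' by apply: filter_all.
elim: s' => [|m s' IH] /=; first by rewrite mul1mx rank_shifts_jblock.
move=> /andP[ml /IH {}IH]; rewrite -mulmxA jblock_subC eqmxMfull //.
by rewrite row_full_unit jblock_unit // subr_eq0 eq_sym.
Qed.

Lemma sim_kron_unit n (A : 'M[K]_n) : sim (kron A (1%:M : 'M_1)) A.
Proof.
exists (\mxrow_(j < n) delta_mx j 0), (\mxcol_(i < n) delta_mx 0 i); split.
- rewrite mul_mxrow_mxcol mx1_sum_delta; apply: eq_bigr => i _.
  by rewrite mul_delta_mx.
- rewrite mul_mxcol_mxrow -[RHS]kron1; apply/eq_mxblock => i j.
  rewrite mul_delta_mx_cond !mxE; case: eqP => _; rewrite ?scale0r ?scale1r ?mulr0n //.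
  by apply/matrixP => k l; rewrite !ord1 !mxE.
- rewrite mul_mxrow_mxblock mul_mxrow; apply/eq_mxrow => j.
  under eq_bigr do rewrite -scalemxAr mulmx1.
  apply/matrixP => i k; rewrite summxE !mxE ord1 [LHS](bigD1 i) //= [RHS](bigD1 j) //=.
  rewrite !mxE !eqxx !mulr1 !big1 ?addr0 // => l lj; rewrite !mxE.
    by rewrite (negPf lj) mulr0.
  by rewrite eq_sym (negPf lj) mulr0.
Qed.

Variable w : K.
Hypotheses (w2 : w * w = - 1) (K2 : 2%:R != 0 :> K).

Let u c : 'M[K]_(1, 1 + 1) := row_mx 1%:M (- c)%:M.
Let v c : 'M[K]_(1 + 1, 1) := col_mx (2%:R^-1)%:M (c / 2%:R)%:M.
Definition rot_mx a b : 'M[K]_(1 + 1) := block_mx a%:M b%:M (- b)%:M a%:M.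

(** [u c] is a left eigenvector of the rotation block, with eigenvalue [a + c b]. *)
Lemma kron_eig n (a b c : K) : c * c = - 1 ->
  kron 1%:M (u c) *m (kron (1%:M : 'M_n) (rot_mx a b) + kron (superdiag K n) 1%:M) =
  kron (jblock (a + c * b) n) 1%:M *m kron 1%:M (u c).
Proof.
move=> c2; rewrite mulmxDr !kron_mul !(mulmx1, mul1mx) /jblock kronDl; congr (_ + _).
rewrite -[(a + c * b)%:M]scalemx1 kronZl -kronZr; congr kron.
have -> // : u c *m rot_mx a b = (a + c * b) *: u c.
  rewrite /u /rot_mx mul_row_block !mul_scalar_mx !scale_scalar_mx -!raddfD /= scale_row_mx.
  rewrite !scale_scalar_mx; congr row_mx; congr _%:M; first by ring.
  by rewrite mulrDl !mul1r !mulrN mulrAC c2; ring.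
Qed.

(** Where -1 has a square root [w], the left eigenvectors for [a + w b] and [a - w b]
    form a basis, in which [C_n(a, b)] becomes [J_n(a + w b)] and [J_n(a - w b)]. *)
Lemma sim_rot n (a b : K) :
  sim (kron (1%:M : 'M_n) (rot_mx a b) + kron (superdiag K n) 1%:M)
      (dirsum (jblock (a + w * b) n) (jblock (a - w * b) n)).
Proof.
apply: sim_trans (sim_dirsum (sim_kron_unit _) (sim_kron_unit _)).
exists (col_mx (kron 1%:M (u w)) (kron 1%:M (u (- w)))),
  (row_mx (kron 1%:M (v w)) (kron 1%:M (v (- w)))).
have h2 : 2%:R^-1 + 2%:R^-1 = 1 :> K by rewrite -mulr2n -[_ *+ 2]mulr_natl divff.
split.
- rewrite mul_col_row !kron_mul !mulmx1 !mul_row_col !mul_scalar_mx !scale_scalar_mx.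
  rewrite -!raddfD /= !mul1r !mulNr !mulrN !mulrA w2 !mulNr !opprK mul1r h2 addrN raddf0.
  by rewrite !kron1 kron0r -scalar_mx_block.
- rewrite mul_row_col !kron_mul -kronDr !mulmx1 -[RHS]kron1; congr kron.
  rewrite !mul_col_row !mul_scalar_mx !scale_scalar_mx add_block_mx -!raddfD /=.
  rewrite scalar_mx_block !mulr1 !mulNr !mulrN !opprK h2 addrN addNr raddf0.
  rewrite (_ : w / 2%:R * w = - 2%:R^-1) ?opprK ?h2 //.
  by rewrite mulrAC w2 mulN1r.
- rewrite mul_col_mx /dirsum mul_block_col !mul0mx addr0 add0r; congr col_mx.
  + exact: kron_eig.
  + by rewrite -[a - _]/(a + - (w * b)) -mulNr; apply: kron_eig; rewrite mulrNN.
Qed.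

End JordanBlockType.

Section Blocks.
Local Open Scope complex_scope.
Variable R : realType.

(** [inl l] and [inr (a, b)] stand for the eigenvalues of the real blocks [J_n(l)] and
    [C_n(a, b)]. *)
Definition blk := ((R + R * R) * nat)%type.

Definition blk_dim (t : blk) : nat :=
  if t.1 is inl _ then t.2 else complex_jordan_size t.2.

Definition blk_mx (t : blk) : 'M[R]_(blk_dim t) :=
  match t with
  | (inl l, n) => jordan_block l n
  | (inr ab, n) => complex_jordan_block ab n
  end.

Definition spectrum (t : blk) : seq (R[i] * nat) :=
  match t with
  | (inl l, n) => [:: (l%:C, n)]
  | (inr ab, n) => [:: (ab.1 +i* ab.2, n); (ab.1 -i* ab.2, n)]
  end.

Local Notation toC := (map_mx (real_complex R)).

Lemma map_kron m n p q (M : 'M[R]_(m, n)) (G : 'M[R]_(p, q)) :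
  toC (kron M G) = kron (toC M) (toC G).
Proof. by apply/matrixP => i j; rewrite !mxE rmorphM. Qed.

Lemma map_superdiag n : toC (superdiag R n) = superdiag R[i] n.
Proof. by apply/matrixP => i j; rewrite !mxE rmorph_nat. Qed.

Lemma charC2 : 2%:R != 0 :> R[i].
Proof. by rewrite pnatr_eq0. Qed.

Lemma jordan_type_blk t : jordan_type (toC (blk_mx t)) (spectrum t).
Proof.
case: t => [[l|[a b]] n] /=.
  rewrite jordan_blockE map_mxD map_scalar_mx map_superdiag.
  exact: jordan_type_jblock.
rewrite complex_blockE map_mxD !map_kron !map_mx1 map_superdiag.
have -> : toC (rot_block a b) = rot_mx a%:C b%:C.
  suff e : toC (rot_block a b : 'M_(1 + 1)) = rot_mx a%:C b%:C by exact: e.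
  by rewrite /rot_block map_block_mx !map_scalar_mx /= rmorphN.
have ww : 'i * 'i = - 1 :> R[i] by rewrite -expr2 sqr_i.
have zE : a +i* b = a%:C + 'i * b%:C by rewrite [LHS]complexE.
have zE' : a -i* b = a%:C - 'i * b%:C by rewrite [LHS]complexE /= rmorphN mulrN.
rewrite zE zE'.
apply: jordan_type_sim (sim_sym (sim_rot ww charC2 _ _ _)) _.
exact: jordan_type_dirsum (jordan_type_jblock _ _) (jordan_type_jblock _ _).
Qed.

Lemma jordan_type_blks (l : seq blk) :
  jordan_type (toC (dsum blk_mx l)) (flatten [seq spectrum t | t <- l]).
Proof.
elim: l => [|t l IH] /=.
  by move=> s; rewrite big_nil; apply/eqP; rewrite -leqn0 rank_leq_row.
rewrite /dirsum map_block_mx !map_mx0.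
exact: jordan_type_dirsum (jordan_type_blk t) IH.
Qed.

Lemma sim_map n m (A : 'M[R]_n) (B : 'M[R]_m) : sim A B -> sim (toC A) (toC B).
Proof.
move=> [X [Y [XY YX XA]]]; exists (toC X), (toC Y).
by rewrite -!map_mxM XY YX XA !map_mx1.
Qed.

Section Upper.
Local Open Scope complex_scope.
Variables (n : nat) (A S : 'M[R]_n) (bs : seq (R[i] * nat)).
Hypothesis AS : invariant_skew_form A S.
Hypothesis jA : jordan_type (toC A) bs.

Lemma toC_skew : (toC S)^T = - toC S.
Proof. by case: AS => skS _; rewrite map_trmx skS map_mxN. Qed.

Lemma toC_invariant : (toC A)^T *m toC S + toC S *m toC A = 0.
Proof. by case: AS => _ SA; rewrite map_trmx -!map_mxM -map_mxD SA map_mx0. Qed.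

Definition mult_gt (l : R[i]) k := count (fun b => (b.1 == l) && (k < b.2)%N) bs.

Definition ceig_rank l : nat := eig_rank (toC S) (toC A) l.

Lemma ceig_rank_opp l : ceig_rank (- l) = ceig_rank l.
Proof. exact: eig_rank_opp toC_skew toC_invariant l. Qed.

(** [S] and [A] are real, so conjugation maps [S (A - l)^n] to [S (A - conj l)^n]. *)
Lemma ceig_rank_conj l : ceig_rank l^* = ceig_rank l.
Proof.
rewrite /ceig_rank /eig_rank; congr (_ - _)%N; rewrite /shift_rank.
rewrite -[RHS](mxrank_map (@conjc R : {rmorphism R[i] -> R[i]})); congr (\rank _).
have cR m p (M : 'M[R]_(m, p)) : map_mx (@conjc R) (toC M) = toC M.
  by apply/matrixP => i j; rewrite !mxE conjc_real.
rewrite map_mxM cR; congr (_ *m _).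
elim: (X in nseq X) => [|k IH] /=; first by rewrite map_mx1.
by rewrite IH map_mxM map_mxB cR map_scalar_mx.
Qed.

Lemma ceig_step_le l k : (eig_step (toC S) (toC A) l k <= mult_gt l k)%N.
Proof. by apply: leq_trans (eig_step_le _ _ _ _) _; rewrite (count_gt_rank _ _ jA). Qed.

(** The drops for [l] and [- l] agree, so each is bounded by both numbers of blocks. *)
Lemma ceig_rank_le l : (ceig_rank l <= \sum_(k < n) minn (mult_gt l k) (mult_gt (- l) k))%N.
Proof.
rewrite /ceig_rank eig_rankE; apply: leq_sum => k _.
by rewrite leq_min ceig_step_le -(eig_step_opp toC_skew toC_invariant) ceig_step_le.
Qed.

Lemma block_size_le b : b \in bs -> (b.2 <= n)%N.
Proof.
move=> bbs; have := jA [::]; rewrite /= mxrank1 => ->.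
by rewrite (big_rem b bbs) /= subn0 leq_addr.
Qed.

(** The drops number [2j] and [2j + 1] have an even sum, so their bound, if odd, is missed
    by at least one. *)
Lemma ceig_rank0 N : ~~ odd (ceig_rank 0%R) /\ exists K,
  (ceig_rank 0%R + \sum_(j < N) odd (mult_gt 0%R j.*2 + mult_gt 0%R j.*2.+1) <=
   \sum_(k < K) mult_gt 0%R k)%N.
Proof.
pose st := eig_step (toC S) (toC A) 0.
have dbl (F : nat -> nat) K : (\sum_(k < K.*2) F k = \sum_(j < K) (F j.*2 + F j.*2.+1))%N.
  by elim: K => [|K IH]; rewrite ?big_ord0 // doubleS !big_ord_recr /= IH addnA.
have st0 k : (n <= k)%N -> st k = 0%N.
  move=> nk; apply/eqP; rewrite -leqn0; apply: leq_trans (ceig_step_le _ _) _.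
  rewrite leqn0 -leqn0 leqNgt -has_count; apply/hasPn => b /block_size_le bn.
  by rewrite negb_and -leqNgt orbC (leq_trans bn nk).
have eE K : (n <= K.*2)%N -> ceig_rank 0%R = (\sum_(j < K) (st j.*2 + st j.*2.+1))%N.
  move=> nK; rewrite -(dbl st) /ceig_rank eig_rankE -!(big_mkord xpredT st).
  rewrite (big_cat_nat (leq0n n) nK) //= [X in (_ + X)%N]big_nat_cond.
  by rewrite [X in (_ + X)%N]big1 ?addn0 // => k /andP[/andP[/st0]].
have ev j : ~~ odd (st j.*2 + st j.*2.+1) by apply: (even_eig_step toC_skew toC_invariant charC2).
split.
  rewrite (eE n) -?addnn ?leq_addr //.
  by elim/big_ind: _ => // x y; rewrite oddD => /negPf-> /negPf->.
set K := maxn n N; exists K.*2; rewrite (eE K); last by rewrite /K; lia.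
rewrite (dbl (mult_gt 0%R)).
have NK : (N <= K)%N by rewrite leq_maxr.
apply: leq_trans (_ : \sum_(j < K) (st j.*2 + st j.*2.+1) +
  \sum_(j < K) odd (mult_gt 0%R j.*2 + mult_gt 0%R j.*2.+1) <= _)%N.
  rewrite leq_add2l.
  rewrite -!(big_mkord xpredT
    (fun j => nat_of_bool (odd (mult_gt 0%R j.*2 + mult_gt 0%R j.*2.+1)))).
  by rewrite [leqRHS](big_cat_nat (leq0n N) NK) //= leq_addr.
rewrite -big_split /=; apply: leq_sum => j _.
have := ceig_step_le 0%R j.*2; have := ceig_step_le 0%R j.*2.+1; rewrite -/(st _) -/(st _).
have := ev j; move: (st _) (st _) (mult_gt _ _) (mult_gt _ _) => x y z t; lia.
Qed.

Lemma rank_sum_ceig (L : seq R[i]) : uniq L -> {subset [seq b.1 | b <- bs] <= L} ->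
  \rank S = (\sum_(l <- L) ceig_rank l)%N.
Proof.
move=> uL bL; rewrite -(mxrank_map (real_complex R)) (rank_eig_sum toC_invariant uL).
suff -> : shift_rank (toC S) (toC A) (flatten [seq nseq n l | l <- L]) = 0%N by rewrite addn0.
apply/eqP; rewrite -leqn0 /shift_rank; apply: leq_trans (mxrankM_maxr _ _) _.
rewrite jA big_seq big1 // => b bbs; apply/eqP; rewrite subn_eq0.
apply: leq_trans (block_size_le bbs) _.
have : b.1 \in L by apply: bL; apply: map_f.
elim: L {uL bL} => // l L IH; rewrite inE /= count_cat.
case/orP => [/eqP->|/IH]; last by move=> h; apply: leq_trans h (leq_addl _ _).
by rewrite count_nseq /= eqxx mul1n leq_addr.
Qed.

End Upper.
End Blocks.

(** * The blocks of a Jordan form *)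

Section JordanBlocksList.
Local Open Scope complex_scope.
Variable R : realType.
Implicit Type J : jordan_data R.

Definition real_blk (l : R) (n : nat) : blk R := (inl l, n).
Definition complex_blk (ab : R * R) (n : nat) : blk R := (inr ab, n).

Definition signed_blks (T : Type) (opp : T -> T) (mk : T -> nat -> blk R)
    (F : signed_blocks T) : seq (blk R) :=
  flatten [seq [seq mk (eigval mu) n | n <- pos_sizes mu] ++
               [seq mk (opp (eigval mu)) n | n <- neg_sizes mu] | mu <- enum 'I_(nvals F)].

Definition real0_blks J := [seq real_blk 0 n | n <- Defs.real0 J].
Definition real1_blks J := signed_blks -%R real_blk (Defs.real1 J).
Definition complex0_blks J := [seq complex_blk (0, nb.2) nb.1 | nb <- complex0 J].
Definition complex1_blks J :=
  signed_blks (fun ab => (- ab.1, ab.2)) complex_blk (complex1 J).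

Definition jordan_blks J :=
  (real0_blks J ++ real1_blks J) ++ (complex0_blks J ++ complex1_blks J).

Lemma sim_blk (t : blk R) : sim (blk_mx t) (dsum (@blk_mx R) [:: t]).
Proof. exact: sim_sym (sim_dirsum0 _ _). Qed.

Lemma sim_blocks_mx (T : Type) (bdim : nat -> nat) (B : T -> forall n, 'M[R]_(bdim n))
    (mk : T -> nat -> blk R) (v : T) s :
  (forall n, sim (B v n) (blk_mx (mk v n))) ->
  sim (blocks_mx B v s) (dsum (@blk_mx R) [seq mk v n | n <- s]).
Proof.
move=> sB.
have -> : [seq mk v n | n <- s] =
    flatten [seq [:: mk v (nth 0%N s i)] | i : 'I_(size s) <- enum 'I_(size s)].
  rewrite flatten_map1 (map_comp (mk v \o nth 0%N s) val) val_enum_ord map_comp.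
  by rewrite map_nth_iota0 // take_size.
apply: sim_mxdiag => i; apply: sim_trans (sB _) _; exact: sim_blk.
Qed.

Lemma sim_signed_mx (T : Type) (opp : T -> T) (bdim : nat -> nat)
    (B : T -> forall n, 'M[R]_(bdim n)) (mk : T -> nat -> blk R) (F : signed_blocks T) :
  (forall v n, sim (B v n) (blk_mx (mk v n))) ->
  sim (signed_mx opp B F) (dsum (@blk_mx R) (signed_blks opp mk F)).
Proof.
move=> sB; apply: sim_mxdiag => mu.
apply: sim_trans _ (sim_sym (dsum_cat _ _ _)).
by apply: sim_dirsum; apply: sim_blocks_mx.
Qed.

Lemma sim_jordan_mx J : sim (jordan_mx J) (dsum (@blk_mx R) (jordan_blks J)).
Proof.
apply: sim_trans _ (sim_sym (dsum_cat _ _ _)); apply: sim_dirsum.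
  apply: sim_trans _ (sim_sym (dsum_cat _ _ _)); apply: sim_dirsum.
    by apply: sim_blocks_mx => n; apply: sim_refl.
  by apply: sim_signed_mx => v n; apply: sim_refl.
apply: sim_trans _ (sim_sym (dsum_cat _ _ _)); apply: sim_dirsum; last first.
  by apply: sim_signed_mx => v n; apply: sim_refl.
have -> : complex0_blks J = flatten [seq
   [:: complex_blk (0, (tnth (in_tuple (complex0 J)) r).2) (tnth (in_tuple (complex0 J)) r).1]
   | r : 'I_(size (complex0 J)) <- enum 'I_(size (complex0 J))].
  rewrite flatten_map1 (map_comp (fun nb => complex_blk (0, nb.2) nb.1)
    (tnth (in_tuple (complex0 J)))).
  by rewrite map_tnth_enum.
apply: sim_mxdiag => i; exact: sim_blk.
Qed.

End JordanBlocksList.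

Section Multiplicities.
Local Open Scope complex_scope.
Variable R : realType.

Definition blks_gt (ts : seq (blk R)) (l : R[i]) k :=
  mult_gt (flatten [seq spectrum t | t <- ts]) l k.

Lemma blks_gt_cat t1 t2 l k :
  blks_gt (t1 ++ t2) l k = (blks_gt t1 l k + blks_gt t2 l k)%N.
Proof. by rewrite /blks_gt /mult_gt map_cat flatten_cat count_cat. Qed.

Lemma blks_gt_real x s l k :
  blks_gt [seq real_blk x n | n <- s] l k = ((x%:C == l) * count (ltn k) s)%N.
Proof.
rewrite /blks_gt /mult_gt; elim: s => [|n s IH] /=; first by rewrite muln0.
by rewrite IH mulnDr; case: eqP; rewrite ?mul0n ?mul1n.
Qed.

Lemma blks_gt_complex ab s l k :
  blks_gt [seq complex_blk ab n | n <- s] l k =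
  (((ab.1 +i* ab.2 == l)%C + (ab.1 -i* ab.2 == l)%C) * count (ltn k) s)%N.
Proof.
rewrite /blks_gt /mult_gt; elim: s => [|n s IH] /=; first by rewrite muln0.
rewrite IH mulnDr; case: (_ == l); case: (_ == l); case: (_ < _)%N => /=; lia.
Qed.

Lemma blks_gt_complex0 (s : seq (nat * R)) l k :
  blks_gt [seq complex_blk (0, nb.2) nb.1 | nb <- s] l k =
  (\sum_(nb <- s) ((Complex 0%R nb.2 == l) + (Complex 0%R (- nb.2)%R == l)) * (k < nb.1))%N.
Proof.
rewrite /blks_gt /mult_gt; elim: s => [|nb s IH] /=; first by rewrite big_nil.
rewrite big_cons -IH; case: (_ == l); case: (_ == l); case: (_ < _)%N => /=; lia.
Qed.

Lemma blks_gt_signed (T : Type) (opp : T -> T) (mk : T -> nat -> blk R) (F : signed_blocks T)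
    (e : T -> nat) l k :
  (forall v s, blks_gt [seq mk v n | n <- s] l k = e v * count (ltn k) s)%N ->
  blks_gt (signed_blks opp mk F) l k =
  (\sum_(mu < nvals F) (e (eigval mu) * count (ltn k) (pos_sizes mu) +
                        e (opp (eigval mu)) * count (ltn k) (neg_sizes mu)))%N.
Proof.
move=> eE; rewrite -big_enum /signed_blks; elim: (enum _) => [|mu s IH] /=.
  by rewrite big_nil.
by rewrite big_cons !blks_gt_cat IH !eE.
Qed.

Variable J : jordan_data R.

Lemma blks_gtE x y k : blks_gt (jordan_blks J) (Complex x y) k = (
  ((0%R == x) && (0%R == y)) * count (ltn k) (Defs.real0 J) +
  \sum_(mu < nvals (Defs.real1 J))
     (((eigval mu == x) && (0%R == y)) * count (ltn k) (pos_sizes mu) +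
      ((- eigval mu == x)%R && (0%R == y)) * count (ltn k) (neg_sizes mu)) +
  \sum_(nb <- complex0 J)
     (((0%R == x) && (nb.2 == y)) + ((0%R == x) && (- nb.2 == y)%R)) * (k < nb.1) +
  \sum_(mu < nvals (complex1 J))
     ((((eigval mu).1 == x) && ((eigval mu).2 == y)) +
      (((eigval mu).1 == x) && (- (eigval mu).2 == y)%R)) * count (ltn k) (pos_sizes mu) +
  \sum_(mu < nvals (complex1 J))
     (((- (eigval mu).1 == x)%R && ((eigval mu).2 == y)) +
      ((- (eigval mu).1 == x)%R && (- (eigval mu).2 == y)%R)) * count (ltn k) (neg_sizes mu))%N.
Proof.
rewrite !blks_gt_cat blks_gt_real blks_gt_complex0 eq_complex /=.
rewrite (@blks_gt_signed _ _ _ _ (fun v => nat_of_bool ((v == x) && (0%R == y))));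
  last by move=> v s; rewrite blks_gt_real eq_complex.
rewrite (@blks_gt_signed _ _ _ _ (fun ab => (((ab.1 == x) && (ab.2 == y)) +
  ((ab.1 == x) && (- ab.2 == y)%R)))%N); last first.
  by move=> v s; rewrite blks_gt_complex !eq_complex.
under [X in (_ + (X + _))%N]eq_bigr do rewrite !eq_complex /=.
by rewrite -[RHS]addnA -big_split /= !addnA.
Qed.

End Multiplicities.

(** * The upper bound *)

Section Upper.
Local Open Scope complex_scope.
Variables (R : realType) (J : jordan_data R).
Hypothesis hJ : jordan_data_wf J.

(** The unavoidable loss of rank on the blocks with eigenvalue 0. *)
Definition odd_excess : nat :=
  (\sum_(l < (real_dim J).+1 | odd l) (count_mem (l : nat) (Defs.real0 J) %% 2))%N.

Definition signed_overlap (T : Type) (F : signed_blocks T) : nat :=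
  (\sum_(mu < nvals F) overlap (pos_sizes mu) (neg_sizes mu))%N.

Local Notation r1 := (Defs.real1 J).
Local Notation c1 := (complex1 J).

Let lam_gt0 : forall mu : 'I_(nvals r1), 0 < eigval mu.
Proof. by case: hJ => _ []. Qed.
Let lam_inj : injective (@eigval _ r1).
Proof. by case: hJ => _ []. Qed.
Let ab_gt0 : forall mu : 'I_(nvals c1), 0 < (eigval mu).1 /\ 0 < (eigval mu).2.
Proof. by case: hJ => _ _ _ []. Qed.
Let ab_inj : injective (@eigval _ c1).
Proof. by case: hJ => _ _ _ []. Qed.
Let b_gt0 : forall nb, nb \in complex0 J -> 0 < nb.2.
Proof. by case: hJ => _ _ h _ nb /h[]. Qed.
Let sorted_r1 : forall mu : 'I_(nvals r1), sorted geq (pos_sizes mu) /\ sorted geq (neg_sizes mu).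
Proof. by case: hJ => _ [_ _ h] _ _ mu; have [/andP[_ ?] /andP[_ ?]] := h mu. Qed.
Let sorted_c1 : forall mu : 'I_(nvals c1), sorted geq (pos_sizes mu) /\ sorted geq (neg_sizes mu).
Proof. by case: hJ => _ _ _ [_ _ h] mu; have [/andP[_ ?] /andP[_ ?]] := h mu. Qed.

Local Notation gt x y k := (blks_gt (jordan_blks J) (Complex x y) k).

(** The comparisons that rule out coincidences between eigenvalues lying in different
    quadrants or on different half-axes. *)
Let sign_neq (x y : R) : 0 < x -> 0 < y ->
  ((0 == x) = false) * ((0 == - x) = false) * ((x == 0) = false) * ((- x == 0) = false) *
  ((x == - y) = false) * ((- x == y) = false).
Proof.
move=> x0 y0; do !split; apply/negbTE/eqP => e; lra.
Qed.

Lemma blks_gt_at0 k : gt 0 0 k = count (ltn k) (Defs.real0 J).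
Proof.
rewrite blks_gtE eqxx mul1n !big1_seq ?addn0 // => [mu _|mu _|nb /andP[_ nbJ]|mu _].
- by have [a0 b0] := ab_gt0 mu; rewrite ?(sign_neq a0 b0).
- by have [a0 b0] := ab_gt0 mu; rewrite ?(sign_neq a0 b0).
- by rewrite ?(sign_neq (b_gt0 nbJ) ltr01).
- by rewrite ?(sign_neq (lam_gt0 mu) ltr01).
Qed.

Lemma blks_gt_at_real mu k : gt (eigval mu) 0 k = count (ltn k) (@pos_sizes _ r1 mu).
Proof.
rewrite blks_gtE eqxx !(sign_neq (lam_gt0 mu) ltr01) [X in (_ + X + _ + _)%N]big1_seq; last first.
  by move=> nb _; rewrite ?(sign_neq (lam_gt0 mu) ltr01).
rewrite [X in (_ + X + _)%N]big1; last first.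
  by move=> nu _; have [a0 b0] := ab_gt0 nu; rewrite ?(sign_neq b0 ltr01) !andbF.
rewrite [X in (_ + _ + X)%N]big1; last first.
  by move=> nu _; have [a0 b0] := ab_gt0 nu; rewrite ?(sign_neq b0 ltr01) !andbF.
rewrite (bigD1 mu) //= eqxx (sign_neq (lam_gt0 mu) (lam_gt0 mu)) big1 ?addn0 ?mul1n //.
move=> nu ne; rewrite (sign_neq (lam_gt0 nu) (lam_gt0 mu)) (inj_eq lam_inj) (negPf ne).
by [].
Qed.

Lemma blks_gt_at_realN mu k : gt (- eigval mu) 0 k = count (ltn k) (@neg_sizes _ r1 mu).
Proof.
rewrite blks_gtE eqxx !(sign_neq (lam_gt0 mu) ltr01) [X in (_ + X + _ + _)%N]big1_seq; last first.
  by move=> nb _; rewrite ?(sign_neq (lam_gt0 mu) ltr01).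
rewrite [X in (_ + X + _)%N]big1; last first.
  by move=> nu _; have [a0 b0] := ab_gt0 nu; rewrite ?(sign_neq b0 ltr01) !andbF.
rewrite [X in (_ + _ + X)%N]big1; last first.
  by move=> nu _; have [a0 b0] := ab_gt0 nu; rewrite ?(sign_neq b0 ltr01) !andbF.
rewrite (bigD1 mu) //= eqxx (sign_neq (lam_gt0 mu) (lam_gt0 mu)) big1 ?addn0 ?mul1n //.
move=> nu ne; rewrite (sign_neq (lam_gt0 nu) (lam_gt0 mu)) eqr_opp (inj_eq lam_inj) (negPf ne).
by [].
Qed.

Lemma blks_gt_at_imag b k : 0 < b ->
  gt 0 b k = (\sum_(nb <- complex0 J) (nb.2 == b) * (k < nb.1))%N.
Proof.
move=> b0; rewrite blks_gtE (sign_neq b0 ltr01) andbF mul0n add0n.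
rewrite [X in (X + _ + _ + _)%N]big1; last by move=> nu _; rewrite !andbF.
rewrite [X in (_ + X + _)%N]big1; last first.
  by move=> nu _; have [a0 _] := ab_gt0 nu; rewrite ?(sign_neq a0 ltr01).
rewrite [X in (_ + _ + X)%N]big1; last first.
  by move=> nu _; have [a0 _] := ab_gt0 nu; rewrite ?(sign_neq a0 ltr01).
rewrite !addn0 add0n; apply: eq_big_seq => nb nbJ.
by rewrite eqxx (sign_neq (b_gt0 nbJ) b0) addn0.
Qed.

Lemma blks_gt_at_complex mu k :
  gt (eigval mu).1 (eigval mu).2 k = count (ltn k) (@pos_sizes _ c1 mu).
Proof.
have [a0 b0] := ab_gt0 mu; rewrite blks_gtE !(sign_neq a0 b0) add0n.
rewrite big1; last by move=> nu _; rewrite ?(sign_neq b0 ltr01) !andbF.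
rewrite big1; last by move=> nb _; rewrite ?(sign_neq a0 ltr01).
rewrite [X in (_ + X)%N]big1; last first.
  by move=> nu _; have [a1 b1] := ab_gt0 nu; rewrite ?(sign_neq a1 a0).
rewrite (bigD1 mu) //= !eqxx (sign_neq b0 b0) big1 ?addn0 ?mul1n //.
move=> nu ne; have [a1 b1] := ab_gt0 nu; rewrite (sign_neq b1 b0) andbF.
by rewrite -xpair_eqE -!surjective_pairing (inj_eq ab_inj) (negPf ne).
Qed.

Lemma blks_gt_at_complexN mu k :
  gt (- (eigval mu).1) (- (eigval mu).2) k = count (ltn k) (@neg_sizes _ c1 mu).
Proof.
have [a0 b0] := ab_gt0 mu; rewrite blks_gtE !(sign_neq a0 b0) add0n.
rewrite big1; last by move=> nu _; rewrite ?(sign_neq b0 ltr01) !andbF.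
rewrite big1; last by move=> nb _; rewrite ?(sign_neq a0 ltr01).
rewrite [X in (X + _)%N]big1; last first.
  by move=> nu _; have [a1 b1] := ab_gt0 nu; rewrite ?(sign_neq a1 a0).
rewrite (bigD1 mu) //= !eqxx (sign_neq b0 b0) big1 ?addn0 ?mul1n //.
move=> nu ne; have [a1 b1] := ab_gt0 nu; rewrite (sign_neq b1 b0) andbF.
by rewrite !eqr_opp -xpair_eqE -!surjective_pairing (inj_eq ab_inj) (negPf ne).
Qed.

Section Form.
Variable S : 'M[R]_(jordan_dim J).
Hypothesis hS : invariant_skew_form (jordan_mx J) S.

Let bs := flatten [seq spectrum t | t <- jordan_blks J].
Let D := ceig_rank (jordan_mx J) S.

Let jbs : jordan_type (map_mx (real_complex R) (jordan_mx J)) bs.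
Proof.
exact: jordan_type_sim (sim_map (sim_sym (sim_jordan_mx J))) (jordan_type_blks _).
Qed.

Let D_le x y (s t : seq nat) : sorted geq s -> sorted geq t ->
  (forall k, gt x y k = count (ltn k) s) -> (forall k, gt (- x) (- y) k = count (ltn k) t) ->
  (D (Complex x y) <= overlap s t)%N.
Proof.
move=> ss st gs gt_; apply: leq_trans (ceig_rank_le hS jbs _) _.
apply: leq_trans (sum_minn_overlap (jordan_dim J) ss st).
by apply: leq_sum => k _; rewrite -gs -gt_.
Qed.

Let D_zero : ~~ odd (D 0) /\ (D 0%R + odd_excess <= sumn (Defs.real0 J))%N.
Proof.
have [ev [K DK]] := ceig_rank0 hS jbs (real_dim J).+1./2; split=> //.
apply: leq_trans (sum_count_gt K _).
under [leqRHS]eq_bigr do rewrite -blks_gt_at0.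
apply: leq_trans DK; rewrite leq_add2l /odd_excess.
rewrite (@sum_odd_half _ (fun l => count_mem l _ %% 2)%N).
apply: leq_sum => j _; rewrite modn2.
have gE k : mult_gt bs 0 k = count (ltn k) (Defs.real0 J) by rewrite -blks_gt_at0.
rewrite !gE; move: j.*2 => k.
suff -> : count (ltn k) (Defs.real0 J) =
  (count_mem k.+1 (Defs.real0 J) + count (ltn k.+1) (Defs.real0 J))%N.
  by rewrite -addnA addnn oddD odd_double addbF.
elim: (Defs.real0 J) => //= x s ->; lia.
Qed.

(** Representatives on the positive real half-axis, the positive imaginary half-axis and
   the first quadrant. *)
Let P := [seq (eigval mu)%:C | mu <- enum 'I_(nvals r1)].
Let Q := [seq Complex 0 b | b <- undup [seq nb.2 | nb <- complex0 J]].
Let W := [seq Complex (eigval mu).1 (eigval mu).2 | mu <- enum 'I_(nvals c1)].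

(** The half-axis or open quadrant of [z]. *)
Let key (z : R[i]) := let: Complex x y := z in (0 < x, x < 0, 0 < y, y < 0).

(** All eigenvalues, each once, grouped by half-axes and quadrants so that the symmetries
    [z |-> - z] and [z |-> conj z] permute the groups. *)
Let keyed : seq ((bool * bool * bool * bool) * seq R[i]) := [::
  ((false, false, false, false), [:: 0]);
  ((true, false, false, false), P);
  ((false, true, false, false), map -%R P);
  ((false, false, true, false), Q);
  ((false, false, false, true), map -%R Q);
  ((true, false, true, false), W);
  ((false, true, false, true), map -%R W);
  ((true, false, false, true), map (@conjc R) W);
  ((false, true, true, false), map (fun z => - conjc z) W)].

Let L := flatten (unzip2 keyed).

Let lt0E (x : R) (x0 : 0 < x) :
  (0 < x = true) * (x < 0 = false) * (0 < - x = false) * (- x < 0 = true).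
Proof. by rewrite oppr_gt0 oppr_lt0 x0 (ltNge x) (ltW x0). Qed.

Let uniqP : uniq P.
Proof.
rewrite map_inj_uniq ?enum_uniq // => mu nu; move/complexI; exact: lam_inj.
Qed.
Let uniqQ : uniq Q.
Proof. by rewrite map_inj_uniq ?undup_uniq // => x y []. Qed.
Let uniqW : uniq W.
Proof.
rewrite map_inj_uniq ?enum_uniq // => mu nu [e1 e2]; apply: ab_inj.
by rewrite [LHS]surjective_pairing e1 e2 -surjective_pairing.
Qed.

Let keyP z : z \in P -> exists2 x, 0 < x & z = Complex x 0.
Proof. by case/mapP => mu _ ->; exists (eigval mu). Qed.
Let keyQ z : z \in Q -> exists2 x, 0 < x & z = Complex 0 x.
Proof.
case/mapP => b; rewrite mem_undup => /mapP[nb nbJ ->] ->.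
by exists nb.2; rewrite // b_gt0.
Qed.
Let keyW z : z \in W -> exists x y, [/\ 0 < x, 0 < y & z = Complex x y].
Proof. by case/mapP => mu _ ->; have [a0 b0] := ab_gt0 mu; exists (eigval mu).1, (eigval mu).2. Qed.

Let uniqL : uniq L.
Proof.
apply: (@uniq_flatten_key _ _ key) => //=.
have cI : injective (@conjc R) := can_inj (@conjcK R).
have ncI : injective (fun z : R[i] => - conjc z) := inj_comp oppr_inj cI.
rewrite !(map_inj_uniq oppr_inj) (map_inj_uniq cI) (map_inj_uniq ncI).
rewrite uniqP uniqQ uniqW !andbT.
rewrite /key /= ltxx eqxx /=.
have onP (p : pred R[i]) : (forall x : R, 0 < x -> p (Complex x 0)) -> all p P.
  by move=> H; apply/allP => z /keyP[x x0 ->]; apply: H.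
have onQ (p : pred R[i]) : (forall x : R, 0 < x -> p (Complex 0 x)) -> all p Q.
  by move=> H; apply/allP => z /keyQ[x x0 ->]; apply: H.
have onW (p : pred R[i]) : (forall x y : R, 0 < x -> 0 < y -> p (Complex x y)) -> all p W.
  by move=> H; apply/allP => z /keyW[x [y [x0 y0 ->]]]; apply: H.
move: onP onQ onW; generalize P Q W => P' Q' W' onP onQ onW; rewrite !all_map.
apply/and5P; split; last (apply/and4P; split).
1,2: by apply: onP => x x0 /=; rewrite ?oppr0 ltxx !(lt0E x0).
1,2: by apply: onQ => x x0 /=; rewrite ?oppr0 ltxx !(lt0E x0).
all: by apply: onW => x y x0 y0 /=; rewrite ?opprK !(lt0E x0) !(lt0E y0).
Qed.

Let real_in (mu : 'I_(nvals r1)) : (eigval mu)%:C \in P.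
Proof. by apply/mapP; exists mu; rewrite ?mem_enum. Qed.
Let imag_in nb : nb \in complex0 J -> Complex 0 nb.2 \in Q.
Proof. by move=> nbJ; apply/mapP; exists nb.2; rewrite ?mem_undup ?map_f. Qed.
Let complex_in (mu : 'I_(nvals c1)) : Complex (eigval mu).1 (eigval mu).2 \in W.
Proof. by apply/mapP; exists mu; rewrite ?mem_enum. Qed.

Let in_L s z : s \in unzip2 keyed -> z \in s -> z \in L.
Proof. by move=> sL zs; apply/flattenP; exists s. Qed.

Let sub_L : {subset [seq b.1 | b <- bs] <= L}.
Proof.
move=> z /mapP[c /flattenP[sp /mapP[t tJ ->]] ct ->].
rewrite !mem_cat in tJ; move: tJ ct => /orP[/orP[]|/orP[]].
- case/mapP => n _ ->; rewrite inE => /eqP -> /=.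
  by apply: (in_L (s := [:: 0])); rewrite !inE eqxx.
- case/flattenP => s /mapP[mu _ ->]; rewrite mem_cat => /orP[] /mapP[n _ ->].
    rewrite inE => /eqP -> /=; apply: in_L (real_in mu); by rewrite !inE eqxx !orbT.
  rewrite inE => /eqP -> /=; apply: (in_L (s := map -%R P)); first by rewrite !inE eqxx !orbT.
  by rewrite rmorphN map_f ?real_in.
- case/mapP => nb nbJ ->; rewrite !inE => /orP[]/eqP-> /=.
    by apply: in_L (imag_in nbJ); rewrite !inE eqxx !orbT.
  apply: (in_L (s := map -%R Q)); first by rewrite !inE eqxx !orbT.
  apply/mapP; exists (Complex 0 nb.2); first exact: imag_in.
  by apply/eqP; rewrite eq_complex /= oppr0 !eqxx.
- case/flattenP => s /mapP[mu _ ->]; rewrite mem_cat => /orP[] /mapP[n _ ->];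
    rewrite !inE => /orP[]/eqP-> /=.
  + by apply: in_L (complex_in mu); rewrite !inE eqxx !orbT.
  + apply: (in_L (s := map (@conjc R) W)); first by rewrite !inE eqxx !orbT.
    by apply/mapP; exists (Complex (eigval mu).1 (eigval mu).2).
  + apply: (in_L (s := map (fun z => - conjc z) W)); first by rewrite !inE eqxx !orbT.
    apply/mapP; exists (Complex (eigval mu).1 (eigval mu).2) => //.
    by apply/eqP; rewrite eq_complex /= opprK !eqxx.
  + apply: (in_L (s := map -%R W)); first by rewrite !inE eqxx !orbT.
    by apply/mapP; exists (Complex (eigval mu).1 (eigval mu).2).
Qed.

Let DN z : D (- z) = D z. Proof. exact: ceig_rank_opp. Qed.
Let DC z : D z^* = D z. Proof. exact: ceig_rank_conj. Qed.

Let rankE : \rank S = (D 0%R + (\sum_(z <- P) D z).*2 + (\sum_(z <- Q) D z).*2 +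
  4 * (\sum_(z <- W) D z))%N.
Proof.
have sN s : (\sum_(z <- map -%R s) D z = \sum_(z <- s) D z)%N.
  by rewrite big_map; apply: eq_bigr => z _; rewrite DN.
have sC s : (\sum_(z <- map (@conjc R) s) D z = \sum_(z <- s) D z)%N.
  by rewrite big_map; apply: eq_bigr => z _; rewrite DC.
have sNC s : (\sum_(z <- map (fun z => - conjc z) s) D z = \sum_(z <- s) D z)%N.
  by rewrite big_map; apply: eq_bigr => z _; rewrite DN DC.
rewrite (rank_sum_ceig hS jbs uniqL sub_L) -/D /L big_flatten /keyed /= !big_cons big_nil.
rewrite !big_nil !addn0 !sN sC sNC.
have arith a p q w : (a + (p + (p + (q + (q + (w + (w + (w + w))))))) =
  a + p.*2 + q.*2 + 4 * w)%N by lia.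
exact: arith.
Qed.

(** The parameters [j1], [j2], [j3] collect the contributions of the real eigenvalues, of
    the quadruples [+- a +- i b] and of the imaginary eigenvalues. *)
Theorem rank_upper : exists j1 j2 j3 : nat,
  [/\ (j1.*2 + odd_excess <= sumn (Defs.real0 J) + (signed_overlap r1).*2)%N,
      (j2 <= signed_overlap c1)%N, (j3 <= \sum_(nb <- complex0 J) nb.1)%N &
      \rank S = (j1.*2 + 4 * j2 + j3.*2)%N].
Proof.
have [D0ev D0le] := D_zero.
exists ((D 0%R)./2 + \sum_(z <- P) D z)%N, (\sum_(z <- W) D z)%N, (\sum_(z <- Q) D z)%N.
split.
- have : (\sum_(z <- P) D z <= signed_overlap r1)%N.
    rewrite big_map big_enum; apply: leq_sum => mu _.
    have [sp sn] := sorted_r1 mu; apply: D_le => // k; first exact: blks_gt_at_real.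
    by rewrite oppr0 blks_gt_at_realN.
  by move: D0ev D0le; lia.
- rewrite big_map big_enum; apply: leq_sum => mu _.
  have [sp sn] := sorted_c1 mu; apply: D_le => // k; first exact: blks_gt_at_complex.
  by rewrite blks_gt_at_complexN.
- rewrite big_map -(sum_undup_fibres snd (fun nb : nat * R => nb.1) (complex0 J)).
  rewrite [leqLHS]big_seq [leqRHS]big_seq; apply: leq_sum => b.
  rewrite mem_undup => /mapP[nb nbJ ->].
  apply: leq_trans (ceig_rank_le hS jbs _) _.
  apply: leq_trans (_ : \sum_(k < jordan_dim J) gt 0%R nb.2 k <= _)%N.
    by apply: leq_sum => k _; apply: geq_minl.
  rewrite (eq_bigr _ (fun (k : 'I_(jordan_dim J)) _ => blks_gt_at_imag k (b_gt0 nbJ))).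
  rewrite exchange_big /=; apply: leq_sum => x _.
  by rewrite -big_distrr /= leq_mul2l sum_ltn_ord geq_minr orbT.
- by rewrite rankE; move: D0ev; lia.
Qed.

End Form.
End Upper.

(** * The lower bound *)

Section Lower.
Variable R : realType.
Implicit Type l : seq (blk R).

Definition ranks_upto (d : nat) l (B : nat) : Prop :=
  forall j, (j <= B)%N -> has_rank (dsum (@blk_mx R) l) (d * j).

Lemma has_rank_cat l1 l2 r1 r2 : has_rank (dsum (@blk_mx R) l1) r1 ->
  has_rank (dsum (@blk_mx R) l2) r2 -> has_rank (dsum (@blk_mx R) (l1 ++ l2)) (r1 + r2).
Proof.
move=> h1 h2; apply: has_rank_sim (sim_sym (dsum_cat _ _ _)) _.
exact: has_rank_dirsum.
Qed.

Lemma ranks_upto_perm d l1 l2 B : perm_eq l1 l2 -> ranks_upto d l1 B -> ranks_upto d l2 B.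
Proof. by move=> l12 h j /h; apply: has_rank_sim; apply: dsum_perm. Qed.

Lemma ranks_upto_cat d l1 l2 B1 B2 :
  ranks_upto d l1 B1 -> ranks_upto d l2 B2 -> ranks_upto d (l1 ++ l2) (B1 + B2).
Proof.
move=> h1 h2 j jB.
have -> : (d * j = d * minn j B1 + d * (j - minn j B1))%N by rewrite -mulnDr; congr (_ * _)%N; lia.
by apply: has_rank_cat; [apply: h1 | apply: h2]; lia.
Qed.

Lemma ranks_upto_zero d l : ranks_upto d l 0.
Proof. by move=> j; rewrite leqn0 => /eqP->; rewrite muln0; apply: has_rank0. Qed.

Lemma ranks_upto_flatten d (I : Type) (r : seq I) (L : I -> seq (blk R)) (B : I -> nat) :
  (forall i, ranks_upto d (L i) (B i)) ->
  ranks_upto d (flatten [seq L i | i <- r]) (\sum_(i <- r) B i).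
Proof.
move=> h; elim: r => [|i r IH] /=; first by rewrite big_nil; apply: ranks_upto_zero.
by rewrite big_cons; apply: ranks_upto_cat.
Qed.

Lemma ranks_upto_one d (t : blk R) B : (forall j, (j <= B)%N -> has_rank (blk_mx t) (d * j)) ->
  ranks_upto d [:: t] B.
Proof. by move=> h j /h; apply: has_rank_sim; apply: sim_blk. Qed.

Lemma ranks_upto_two d (t u : blk R) B :
  (forall j, (j <= B)%N -> has_rank (dirsum (blk_mx t) (blk_mx u)) (d * j)) ->
  ranks_upto d [:: t; u] B.
Proof.
move=> h j /h; apply: has_rank_sim.
exact: sim_dirsum (sim_refl _) (sim_blk _).
Qed.

(** The [r]-th blocks of the two signs are coupled; blocks without partner get rank 0. *)
Lemma ranks_upto_signed d (T : Type) (opp : T -> T) (mk : T -> nat -> blk R) (F : signed_blocks T) :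
  (forall v n m, ranks_upto d [:: mk v n; mk (opp v) m] (minn n m)) ->
  ranks_upto d (signed_blks opp mk F) (signed_overlap F).
Proof.
move=> h; rewrite /signed_overlap -big_enum; apply: ranks_upto_flatten => mu.
elim: (pos_sizes mu) (neg_sizes mu) => [|n s IH] [|m t] /=.
- by rewrite /overlap big_ord0; apply: ranks_upto_zero.
- by rewrite /overlap big1 => [|i _]; [apply: ranks_upto_zero | rewrite nth_nil min0n].
- by rewrite /overlap big1 => [|i _]; [apply: ranks_upto_zero | rewrite nth_nil minn0].
have -> : overlap (n :: s) (m :: t) = (minn n m + overlap s t)%N.
  by rewrite /overlap /= maxnSS big_ord_recl.
apply: (@ranks_upto_perm _ ([:: mk (eigval mu) n; mk (opp (eigval mu)) m] ++
  ([seq mk (eigval mu) n | n <- s] ++ [seq mk (opp (eigval mu)) n | n <- t]))).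
  by rewrite /= perm_cons -cat1s perm_catCA.
exact: ranks_upto_cat.
Qed.

(** Blocks of equal size are coupled two by two, as blocks with eigenvalues 0 and - 0,
    which gives full rank; a remaining block of odd size loses one unit. *)
Lemma ranks_upto_real0_nseq x c : ranks_upto 2 (nseq c (real_blk (0 : R) x)) (x * c)./2.
Proof.
elim/ltn_ind: c => -[|[|c]] IH.
- by rewrite muln0; apply: ranks_upto_zero.
- apply: ranks_upto_one => j jx; rewrite mul2n; apply: real_zero_rank.
  by move: jx; rewrite muln1 /blk_dim /=; lia.
have -> : ((x * c.+2)./2 = x + (x * c)./2)%N by lia.
rewrite -[nseq _ _]/([:: real_blk 0 x; real_blk 0 x] ++ nseq c (real_blk 0 x)).
apply: ranks_upto_cat; last by apply: IH.
apply: ranks_upto_two => j jx; rewrite mul2n -[X in dirsum _ (blk_mx (real_blk X _))]oppr0.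
exact: real_pair_rank.
Qed.

Lemma blocks_dim_id s : blocks_dim id s = sumn s.
Proof. by rewrite /blocks_dim sumnE (big_nth 0%N) big_mkord. Qed.

Variable J : jordan_data R.

(** Each odd size with odd multiplicity occurs, and is at least 1. *)
Lemma odd_excess_le : (odd_excess J <= sumn (Defs.real0 J))%N.
Proof.
rewrite /odd_excess; set N := _.+1; move: N => N.
apply: leq_trans (_ : \sum_(l < N | odd l) count_mem (l : nat) (Defs.real0 J) <= _)%N.
  by apply: leq_sum => l _; apply: leq_mod.
elim: (Defs.real0 J) => [|x s IH]; first by rewrite big1.
rewrite /= big_split leq_add //= (@sum_odd_half N (fun i => x == i)).
apply: leq_trans (_ : \sum_(j < N./2) (j < x) <= x)%N; last by rewrite sum_ltn_ord geq_minr.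
by apply: leq_sum => j _; case: eqP => // ->; rewrite -addnn; lia.
Qed.

(** The largest rank obtained from groups of equal sizes is [2 ((x * c) / 2)] for each size
    [x] of multiplicity [c], which falls short of [x * c] exactly when both are odd. *)
Lemma ranks_upto_real0 j : (j.*2 + odd_excess J <= sumn (Defs.real0 J))%N ->
  has_rank (dsum (@blk_mx R) (real0_blks J)) (2 * j).
Proof.
set s := Defs.real0 J => js.
have h : ranks_upto 2 (real0_blks J) (\sum_(x <- undup s) (x * count_mem x s)./2).
  apply: (@ranks_upto_perm _ (flatten [seq nseq (count_mem x s) (real_blk 0 x) | x <- undup s])).
    have /(perm_map (real_blk (0 : R))) := perm_count_undup s; rewrite map_flatten -map_comp.
    by rewrite (@eq_map _ _ _ (fun x => nseq (count_mem x s) (real_blk 0 x))) // => x /=;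
      rewrite map_nseq.
  by apply: ranks_upto_flatten => x; apply: ranks_upto_real0_nseq.
apply: h; rewrite -leq_double; move: js.
have -> : sumn s = (\sum_(x <- undup s) x * count_mem x s)%N.
  rewrite sumnE -(sum_undup_fibres id id s) map_id; apply: eq_bigr => x _.
  rewrite -sum1_count big_distrr [RHS]big_mkcond /=; apply: eq_bigr => y _.
  by rewrite muln1; case: eqP => [->|_]; rewrite ?mul1n.
have -> : (\sum_(x <- undup s) x * count_mem x s = (\sum_(x <- undup s) (x * count_mem x s)./2).*2 +
   \sum_(x <- undup s) odd x * (count_mem x s %% 2))%N.
  rewrite -muln2 big_distrl -big_split /=; apply: eq_bigr => x _.
  by rewrite -{1}(odd_double_half (x * _)) oddM modn2 mulnb addnC muln2.
suff : (\sum_(x <- undup s) odd x * (count_mem x s %% 2) <= odd_excess J)%N by lia.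
rewrite /odd_excess [leqRHS]big_mkcond /=.
apply: leq_trans (sum_uniq_le (N := (real_dim J).+1) _ (undup_uniq s) _) _.
  apply/allP => x; rewrite mem_undup ltnS => xs.
  rewrite /real_dim /real0_dim blocks_dim_id -/s sumnE (big_rem x xs) /=.
  by rewrite -addnA leq_addr.
by apply: leq_sum => l _; case: ifP => ol; rewrite ?mul1n.
Qed.

Theorem rank_lower j1 j2 j3 :
  (j1.*2 + odd_excess J <= sumn (Defs.real0 J) + (signed_overlap (Defs.real1 J)).*2)%N ->
  (j2 <= signed_overlap (complex1 J))%N -> (j3 <= \sum_(nb <- complex0 J) nb.1)%N ->
  has_rank (jordan_mx J) (j1.*2 + 4 * j2 + j3.*2).
Proof.
move=> h1 h2 h3; apply: has_rank_sim (sim_sym (sim_jordan_mx J)) _.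
have -> : (j1.*2 + 4 * j2 + j3.*2 = j1.*2 + (2 * j3 + 4 * j2))%N by lia.
apply: has_rank_cat; last apply: has_rank_cat.
- set o := signed_overlap _ in h1.
  (* Use the blocks with nonzero real eigenvalues first. *)
  have -> : (j1.*2 = 2 * (j1 - o) + 2 * minn j1 o)%N by lia.
  apply: has_rank_cat.
    by apply: ranks_upto_real0; have := odd_excess_le; lia.
  suff : ranks_upto 2 (real1_blks J) o by apply; apply: geq_minr.
  apply: ranks_upto_signed => v n m; apply: ranks_upto_two => j.
  rewrite leq_min mul2n => /andP[jn jm].
  exact: real_pair_rank.
- suff : ranks_upto 2 (complex0_blks J) (\sum_(nb <- complex0 J) nb.1) by apply.
  rewrite /complex0_blks -flatten_map1; apply: ranks_upto_flatten => nb.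
  apply: ranks_upto_one => j jn; rewrite mul2n; exact: complex_zero_rank.
- suff : ranks_upto 4 (complex1_blks J) (signed_overlap (complex1 J)) by apply.
  apply: ranks_upto_signed => -[a b] n m; apply: ranks_upto_two => j.
  rewrite leq_min => /andP[jn jm].
  exact: complex_pair_rank.
Qed.

End Lower.

(** * Presymplectic forms and their Gram matrices *)

Section Bordered.
Variable K : fieldType.
Hypothesis K2 : 2%:R != 0 :> K.
Variables (n : nat) (S : 'M[K]_n).
Hypothesis skS : S^T = - S.

(** The Gram matrix of a form on [g] in the basis [e1 :: e], where [v] is the row
    [omega(e1, .)] and [S] the restriction to the ideal. *)
Definition border (v : 'rV[K]_n) : 'M[K]_(1 + n) := block_mx 0 v (- v^T) S.

Lemma tr_border v : (border v)^T = - border v.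
Proof. by rewrite /border tr_block_mx opp_block_mx trmx0 linearN /= trmxK skS oppr0 opprK. Qed.

(** The rank lies between [\rank S] and [\rank S + 2], and both matrices are skew. *)
Lemma mxrank_border v :
  \rank (border v) = \rank S \/ \rank (border v) = (\rank S).+2 /\ (\rank S < n)%N.
Proof.
have ge : (\rank S <= \rank (border v))%N.
  have -> : S = row_mx 0 1%:M *m border v *m col_mx 0 1%:M.
    by rewrite /border mul_row_block mul_row_col !mul0mx !mul1mx mulmx0 mulmx1 !add0r.
  by apply: leq_trans (mxrankM_maxl _ _) _; apply: mxrankM_maxr.
have le : (\rank (border v) <= (\rank S).+2)%N.
  have -> : border v = block_mx 0 0 0 S + block_mx 0 v (- v^T) 0.
    by rewrite /border add_block_mx !addr0 !add0r.
  apply: leq_trans (mxrank_add _ _) _; rewrite rank_diag_block_mx mxrank0 add0n.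
  rewrite mxrank_antiblock -addn2 leq_add2l -[2%N]/(1.*2)%N leq_double.
  exact: rank_leq_row.
have := skew_rank_even K2 skS; have := skew_rank_even K2 (tr_border v).
have := rank_leq_row (border v); move: le ge.
move: (\rank (border v)) (\rank S) => x y; lia.
Qed.

Lemma mxrank_border0 : \rank (border 0) = \rank S.
Proof.
by rewrite /border trmx0 oppr0 rank_diag_block_mx mxrank0.
Qed.

(** A row outside the row space of [S] already adds 1 to the rank, and then parity adds
    another. *)
Lemma border_rank_incr : (\rank S < n)%N -> exists v, \rank (border v) = (\rank S).+2.
Proof.
move=> Sn; have /row_subPn[i nS] : ~~ (1%:M <= S)%MS.
  by rewrite sub1mx /row_full; move: Sn; rewrite ltn_neqAle => /andP[].
set v := row i 1%:M in nS; exists v.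
have vS : (\rank S < \rank (v + S)%MS)%N.
  apply: rank_ltmx; rewrite ltmxE addsmxSr /=; apply: contra nS.
  by apply: submx_trans; apply: addsmxSl.
have : (\rank (v + S)%MS <= \rank (border v))%N.
  rewrite addsmxE -[col_mx v S](_ : border v *m col_mx 0 1%:M = _) ?mxrankM_maxl //.
  by rewrite /border mul_block_col !mulmx0 !mulmx1 !add0r.
case: (mxrank_border v) => [->|[]//]; move: vS; move: (\rank _) (\rank _) => x y; lia.
Qed.

End Bordered.

Section LieForms.
Variables (R : realType) (g : lieAlgebra R).

Definition gram (omega : {biscalar g}) n (b : n.-tuple g) : 'M[R]_n :=
  \matrix_(i, j) omega b`_i b`_j.

Lemma bilinear_sum n m (omega : {biscalar g}) (x : 'I_n -> R) (u : 'I_n -> g)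
    (y : 'I_m -> R) (w : 'I_m -> g) :
  omega (\sum_i x i *: u i) (\sum_j y j *: w j) =
  \sum_i \sum_j x i * omega (u i) (w j) * y j.
Proof.
rewrite linear_sumlz; apply: eq_bigr => i _; rewrite linear_sumr; apply: eq_bigr => j _.
by rewrite linearZl_LR linearZr_LR mulrAC -mulrA.
Qed.

Lemma gram_rank_le (omega : {biscalar g}) n m (b : n.-tuple g) (c : m.-tuple g) :
  basis_of {:g} c -> (\rank (gram omega b) <= \rank (gram omega c))%N.
Proof.
move=> bc; pose P : 'M_(n, m) := \matrix_(i, k) coord c k b`_i.
have -> : gram omega b = P *m gram omega c *m P^T.
  apply/matrixP => i j; rewrite mxE (coord_basis bc (memvf b`_i)) (coord_basis bc (memvf b`_j)).
  rewrite bilinear_sum exchange_big mxE; apply: eq_bigr => k _ /=.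
  rewrite !mxE big_distrl /=; apply: eq_bigr => l _.
  by rewrite !mxE.
by apply: leq_trans (mxrankM_maxl _ _) _; apply: mxrankM_maxr.
Qed.

Lemma form_rankE (omega : {biscalar g}) n (b : n.-tuple g) :
  basis_of {:g} b -> form_rank omega = \rank (gram omega b).
Proof.
move=> bb; apply/eqP; rewrite eqn_leq -[form_rank _]/(\rank (gram omega (vbasis {:g}))).
by rewrite !gram_rank_le // vbasisP.
Qed.

Section FormOf.
Variables (n : nat) (b : n.-tuple g) (G : 'M[R]_n).

Definition form_of (x y : g) : R := \sum_i \sum_j coord b i x * G i j * coord b j y.

Lemma form_of_bilinear : bilinear_for *%R *%R form_of.
Proof.
split=> [u' a x y|u a x y] /=; rewrite /form_of big_distrr -big_split /=;
  apply: eq_bigr => i _; rewrite big_distrr -big_split /=; apply: eq_bigr => j _;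
  rewrite linearP /=; ring.
Qed.

HB.instance Definition _ := bilinear_isBilinear.Build R g g R *%R *%R form_of form_of_bilinear.

Definition biscalar_of : {biscalar g} := form_of.

Lemma gram_biscalar_of : free b -> gram biscalar_of b = G.
Proof.
move=> fb; apply/matrixP => i j; rewrite mxE /= /form_of.
rewrite (bigD1 i) //= (bigD1 j) //= !coord_free // !eqxx mul1r mulr1.
rewrite !big1 ?addr0 // => [k ki|k kj].
  by rewrite big1 // => l _; rewrite coord_free // eq_sym (negPf ki) !mul0r.
by rewrite !coord_free // [j == k]eq_sym (negPf kj) mulr0.
Qed.

Lemma form_of_skew : G^T = - G -> forall x y, biscalar_of x y = - biscalar_of y x.
Proof.
move=> skG x y; rewrite /= /form_of exchange_big /= -sumrN; apply: eq_bigr => i _.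
rewrite -sumrN; apply: eq_bigr => j _.
have -> : G j i = - G i j by rewrite -[LHS](mxE trmx_key (fun i j => G j i)) -/(G^T) skG mxE.
ring.
Qed.
End FormOf.
End LieForms.

Section AlmostAbelian.
Variables (R : realType) (g : lieAlgebra R) (N : nat) (e1 : g) (e : N.-tuple g).
Hypothesis he : basis_of {:g} (e1 :: e).
Hypothesis hab : abelian_subspace <<e>>%VS.
Hypothesis hid : lie_ideal <<e>>%VS.

Let b := [tuple of e1 :: e].
Local Notation A := (ad_mx e1 e).

Lemma lie_anti (x y : g) : lie x y = - lie y x.
Proof.
apply/eqP; rewrite -addr_eq0; have := lie_alternating (x + y).
by rewrite linearDl !linearDr !lie_alternating add0r addr0 => ->.
Qed.

Let e_in i : e`_i \in <<e>>%VS.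
Proof.
have [ie|ie] := ltnP i (size e); first by rewrite memv_span // mem_nth.
by rewrite nth_default // mem0v.
Qed.

Let lie_e1 (j : 'I_N) : lie e1 e`_j = \sum_i A i j *: e`_i.
Proof.
rewrite [LHS](coord_span (hid e1 (e_in j))); by apply: eq_bigr => i _; rewrite mxE.
Qed.

Variable omega : {biscalar g}.
Hypothesis skew : forall x y, omega x y = - omega y x.

Let S := gram omega e.

Let skS : S^T = - S.
Proof. by apply/matrixP => i j; rewrite !mxE skew. Qed.

Let omega_lie (i j : 'I_N) : omega e`_i (lie e1 e`_j) = (S *m A) i j.
Proof.
rewrite lie_e1 linear_sumr mxE; apply: eq_bigr => k _.
by rewrite linearZr_LR mulrC; congr (_ * _); rewrite [RHS]mxE.
Qed.

Let trSA : (S *m A)^T = - (A^T *m S).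
Proof. by rewrite trmx_mul skS mulmxN. Qed.

Lemma closed_invariant :
  (forall x y z, omega x (lie y z) + omega z (lie x y) + omega y (lie z x) = 0) ->
  A^T *m S + S *m A = 0.
Proof.
move=> closed; suff e' : S *m A = (S *m A)^T by rewrite {1}e' trSA addrN.
apply/matrixP => i j; rewrite [RHS]mxE -!omega_lie.
have := closed e1 e`_j e`_i.
rewrite hab // linear0r add0r (lie_anti e`_i) linearNr.
by move/eqP; rewrite subr_eq0 => /eqP.
Qed.

(** [omega(u, [e1, w])] is symmetric in [u] and [w] on the ideal, because [S A] is
    symmetric.  Writing [x = c e1 + x'] with [x'] in the ideal, and likewise [y] and [z],
    the cyclic sum cancels termwise. *)
Lemma invariant_closed : A^T *m S + S *m A = 0 ->
  forall x y z, omega x (lie y z) + omega z (lie x y) + omega y (lie z x) = 0.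
Proof.
move=> AS.
have SAsym i j : (S *m A) i j = (S *m A) j i.
  have e' : S *m A = (S *m A)^T.
    by rewrite trSA; apply/eqP; rewrite -addr_eq0 addrC AS.
  by rewrite {1}e' mxE.
have sym u w : u \in <<e>>%VS -> w \in <<e>>%VS ->
    omega u (lie e1 w) = omega w (lie e1 u).
  have expand (x y : 'I_N -> R) :
      omega (\sum_i x i *: e`_i) (lie e1 (\sum_j y j *: e`_j)) =
      \sum_i \sum_j x i * (S *m A) i j * y j.
    rewrite linear_sumr; under [X in omega _ X]eq_bigr do rewrite linearZr_LR.
    rewrite /= bilinear_sum; apply: eq_bigr => i _; apply: eq_bigr => j _.
    by rewrite omega_lie.
  move=> /coord_span -> /coord_span ->; rewrite !expand exchange_big /=.
  apply: eq_bigr => i _; apply: eq_bigr => j _; rewrite SAsym; ring.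
have dec x : exists (c : R) (x' : g), x' \in <<e>>%VS /\ x = c *: e1 + x'.
  have : x \in <<e1 :: e>>%VS by rewrite (span_basis he) memvf.
  rewrite span_cons => /memv_addP[v /vlineP[c ->] [w we ->]].
  by exists c, w.
move=> x y z.
have [cx [x' [x'e ->]]] := dec x.
have [cy [y' [y'e ->]]] := dec y.
have [cz [z' [z'e ->]]] := dec z.
have lieE c1 u c2 w : u \in <<e>>%VS -> w \in <<e>>%VS ->
    lie (c1 *: e1 + u) (c2 *: e1 + w) = c1 *: lie e1 w - c2 *: lie e1 u.
  move=> ue we; rewrite linearDl !linearDr !linearZl_LR !linearZr_LR /=.
  rewrite lie_alternating (hab ue we) !scaler0 add0r addr0 (lie_anti u e1) scalerN.
  by [].
rewrite !lieE // !linearDl !linearBr !linearZl_LR !linearZr_LR /=.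
rewrite (sym z' x') // (sym z' y') // (sym y' x') //.
ring.
Qed.

End AlmostAbelian.

Lemma presymplectic_rankP (R : realType) (g : lieAlgebra R) N (e1 : g) (e : N.-tuple g)
    (he : basis_of {:g} (e1 :: e)) (hab : abelian_subspace <<e>>%VS)
    (hid : lie_ideal <<e>>%VS) k :
  admits_presymplectic_of_rank g k <->
  exists2 S, invariant_skew_form (ad_mx e1 e) S &
    k = \rank S \/ k = (\rank S).+2 /\ (\rank S < N)%N.
Proof.
pose b := [tuple of e1 :: e].
have bb : basis_of {:g} b by [].
have R2 : 2%:R != 0 :> R by rewrite pnatr_eq0.
split=> [[omega [[sk closed] <-]]|[S [skS SA] kS]].
  have skS : (gram omega e)^T = - gram omega e.
    by apply/matrixP => i j; rewrite !mxE sk.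
  exists (gram omega e); first by split=> //; apply: closed_invariant.
  rewrite (form_rankE omega bb).
  suff -> : gram omega b = border (gram omega e) (\row_j omega e1 e`_j).
    exact: mxrank_border.
  have om0 : omega e1 e1 = 0.
    by have /eqP := sk e1 e1; rewrite -addr_eq0 -mulr2n mulrn_eq0 /= => /eqP.
  apply: etrans (esym (@submxK _ 1 N 1 N (gram omega b))) _.
  congr block_mx; apply/matrixP => i j; rewrite !mxE //=.
  - by rewrite !ord1.
  - by rewrite !ord1.
  - by rewrite !ord1 /= sk.
have [v rv] : exists v, \rank (border S v) = k.
  case: kS => [->|[-> SN]]; first by exists 0; apply: mxrank_border0.
  exact: border_rank_incr.
pose omega := biscalar_of b (border S v : 'M_N.+1).
have go : gram omega b = border S v by apply: gram_biscalar_of; apply: basis_free bb.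
have sk : forall x y, omega x y = - omega y x.
  by apply: form_of_skew; apply: tr_border.
have ge : gram omega e = S.
  apply/matrixP => i j.
  have := congr1 (fun M : 'M_(1 + N) => M (rshift 1 i) (rshift 1 j)) go.
  by rewrite /border block_mxEdr !mxE.
exists omega; split; last by rewrite (form_rankE omega bb) go.
split=> //; apply: (@invariant_closed _ _ _ _ _ he hab hid _ sk); by rewrite ge.
Qed.

(** * The sets of ranks *)

Section Bounds.
Variables (R : realType) (J : jordan_data R).
Hypothesis hJ : jordan_data_wf J.

Lemma signed_dim_overlap (T : Type) (F : signed_blocks T) d (bdim : nat -> nat) :
  (forall n, bdim n = n * d)%N ->
  signed_dim bdim F = (d * (signed_dist F + (signed_overlap F).*2))%N.
Proof.
move=> bd; have bs s : blocks_dim bdim s = (d * sumn s)%N.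
  rewrite -blocks_dim_id /blocks_dim big_distrr; apply: eq_bigr => i _.
  by rewrite bd mulnC.
rewrite /signed_dim /signed_dist /signed_overlap -muln2 big_distrl -big_split big_distrr /=.
by apply: eq_bigr => mu _; rewrite !bs -mulnDr muln2 manhattan_overlap.
Qed.

(** The Manhattan distance of two partitions is the sum of their sizes minus twice their
    overlap. *)
Lemma real_boundE : real_bound J =
  (sumn (Defs.real0 J) - odd_excess J + (signed_overlap (Defs.real1 J)).*2)%N%:Z.
Proof.
have le := odd_excess_le J.
have -> : real_bound J = (real_dim J)%:Z - ((odd_excess J)%:Z + (signed_dist (Defs.real1 J))%:Z).
  rewrite /real_bound /odd_excess; congr (_ - (_%:Z + _)).
  apply: eq_bigr => l _; congr (_ %% 2)%N.
  case: hJ => _ [_ lam0 _] _ _; rewrite /num_real_blocks eqxx mul1n big1 ?addn0 // => mu _.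
  by rewrite eq_sym (gt_eqF (lam0 mu)) eq_sym oppr_eq0 (gt_eqF (lam0 mu)).
rewrite /real_dim /real0_dim blocks_dim_id /real1_dim.
rewrite (@signed_dim_overlap _ _ 1) => [|n]; last by rewrite muln1.
lia.
Qed.

Lemma complex_jordan_sizeE n : complex_jordan_size n = (n * 2)%N.
Proof. by rewrite /complex_jordan_size sum_nat_const card_ord. Qed.

Lemma complex1_boundE : complex1_bound J = (4 * signed_overlap (complex1 J))%N%:Z.
Proof.
rewrite /complex1_bound /complex1_dim (signed_dim_overlap _ complex_jordan_sizeE); lia.
Qed.

Lemma complex0_dimE : complex0_dim J = (2 * \sum_(nb <- complex0 J) nb.1)%N.
Proof.
rewrite /complex0_dim (big_tnth _ _ (complex0 J)) big_distrr /=; apply: eq_bigr => r _.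
by rewrite complex_jordan_sizeE mulnC.
Qed.

Lemma multiplesP (d B : nat) (r : int) : (0 < d)%N ->
  [set r : int | (d %| r)%Z /\ 0 <= r <= B%:Z] r <->
  exists2 j : nat, (d * j <= B)%N & r = (d * j)%N%:Z.
Proof.
move=> d0; split=> /= [[/dvdzP[q ->] /andP[q0 qB]]|[j jB ->]].
  have q0' : 0 <= q by rewrite -(pmulr_lge0 (x := d%:Z)).
  case: q q0' q0 qB => // j _ _ jB; exists j; last by rewrite mulnC.
  by rewrite mulnC; move: jB; rewrite -PoszM.
by split; [rewrite PoszM dvdz_mulr | lia].
Qed.

Lemma minkowski_ranksP (r : int) :
  minkowski_sum (real_ranks J) (complex_ranks J) r <->
  exists j1 j2 j3 : nat,
  [/\ (j1.*2 + odd_excess J <= sumn (Defs.real0 J) + (signed_overlap (Defs.real1 J)).*2)%N,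
      (j2 <= signed_overlap (complex1 J))%N, (j3 <= \sum_(nb <- complex0 J) nb.1)%N &
      r = (j1.*2 + 4 * j2 + j3.*2)%N%:Z].
Proof.
have le := odd_excess_le J.
split=> [[x xr [y [z zr [t tr <-]] <-]]|[j1 [j2 [j3 [h1 h2 h3 ->]]]]].
  move: xr zr tr; rewrite /real_ranks real_boundE complex1_boundE complex0_dimE.
  move=> /(multiplesP (d := 2%N))[//|j1 h1 ->].
  move=> /(multiplesP (d := 4%N))[//|j2 h2 ->] /(multiplesP (d := 2%N))[//|j3 h3 ->].
  exists j1, j2, j3; split; lia.
exists (2 * j1)%N%:Z.
  by rewrite /real_ranks real_boundE; apply/(multiplesP (d := 2%N)) => //; exists j1 => //; lia.
exists ((4 * j2)%N%:Z + (2 * j3)%N%:Z); last by lia.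
exists (4 * j2)%N%:Z.
  by rewrite complex1_boundE; apply/(multiplesP (d := 4%N)) => //; exists j2 => //; lia.
exists (2 * j3)%N%:Z => //.
by rewrite complex0_dimE; apply/(multiplesP (d := 2%N)) => //; exists j3 => //; lia.
Qed.
End Bounds.

Theorem theorem6p1 (R : realType) (J : jordan_data R) (hJ : jordan_data_wf J)
    (g : lieAlgebra R) (hg : almost_abelian g)
    (e1 : g) (e : (jordan_dim J).-tuple g)
    (he : basis_of {:g} (e1 :: e))
    (hab : abelian_subspace <<e>>%VS) (hid : lie_ideal <<e>>%VS)
    (had : ad_mx e1 e = jordan_mx J)
    (k : nat) (hk : (k <= \dim {:g})%N) :
  admits_presymplectic_of_rank g k <->
  (minkowski_sum (real_ranks J) (complex_ranks J) `|`
   [set r + 2 | r in minkowski_sum (real_ranks J) (complex_ranks J)]) k%:Z.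
Proof.
have dimg : \dim {:g} = (jordan_dim J).+1 by rewrite (size_basis (X := [tuple of e1 :: e]) he).
apply: iff_trans (presymplectic_rankP he hab hid k) _; rewrite had; split.
  move=> [S hS kS]; have [j1 [j2 [j3 [h1 h2 h3 rS]]]] := rank_upper hJ hS.
  have rM : minkowski_sum (real_ranks J) (complex_ranks J) (\rank S)%:Z.
    by apply/(minkowski_ranksP hJ); exists j1, j2, j3; rewrite rS.
  by case: kS => [->|[-> _]]; [left | right; exists (\rank S)%:Z => //; lia].
have ranks r : minkowski_sum (real_ranks J) (complex_ranks J) r ->
    exists2 S, invariant_skew_form (jordan_mx J) S & r = (\rank S)%:Z.
  move=> /(minkowski_ranksP hJ)[j1 [j2 [j3 [h1 h2 h3 ->]]]].
  by have [S hS <-] := rank_lower h1 h2 h3; exists S.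
case=> [/ranks[S hS [kS]]|[r /ranks[S hS ->] kS]]; exists S => //; first by left.
have {}kS : k = (\rank S).+2 by case: kS => <-; rewrite addn2.
(* [S] is degenerate because [k] does not exceed the dimension of [g]. *)
right; split=> //; move: hk; rewrite dimg kS; lia.
Qed.
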